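(* Let $k\ge 4$ be a constant integer. The $k$-AP Hypothesis implies the $k'$-AP Hypothesis for every constant integer $k'\ge k$.
   Context: A $k$-term arithmetic progression ($k$-AP) is a sequence $x,x+d,\dots,x+(k-1)d$; it is non-trivial if $d\neq 0$. $k$-AP Hypothesis: there is no algorithm that decides whether a given set $A\subseteq\{0,\dots,N\}$ contains a non-trivial $k$-AP in time $O(N^{2-\epsilon})$ for any constant $\epsilon>0$. *)

(* Defs.v *)
From Stdlib Require Import Reals ZArith Arith List Bool.

(** * Arithmetic progressions *)

(** Both the start and the common difference range over the integers. *)
Definition has_kAP (k : nat) (A : nat -> bool) : Prop :=
  exists x d : Z, d <> 0%Z /\
    forall i : nat, i < k ->
      exists a : nat, A a = true /\ Z.of_nat a = (x + Z.of_nat i * d)%Z.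

(** * Word RAM

    A program is a finite list of instructions acting on registers and on a
    random-access memory, each instruction costing one time unit.  Semantics
    is over natural numbers; the restriction to words of [w] bits is the
    predicate [fits w], required of every configuration of a run, so that an
    algorithm may never overflow a word. *)

Inductive binop : Type :=
| Add | Sub | Mul | Div | Mod | And | Or | Xor | Shl | Shr | Eqb | Ltb.

(** [Sub] is truncated at [0]; division by [0] yields [0] and [x mod 0 = x]. *)
Definition eval_binop (o : binop) (x y : nat) : nat :=
  match o with
  | Add => x + y
  | Sub => x - y
  | Mul => x * y
  | Div => x / y
  | Mod => x mod y
  | And => Nat.land x y
  | Or => Nat.lor x y
  | Xor => Nat.lxor x y
  | Shl => Nat.shiftl x y
  | Shr => Nat.shiftr x y
  | Eqb => Nat.b2n (x =? y)
  | Ltb => Nat.b2n (x <? y)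
  end.

Inductive instr : Type :=
| Const (r v : nat)              (* R[r] := v *)
| Op (o : binop) (r a b : nat)   (* R[r] := o R[a] R[b] *)
| Read (r a : nat)               (* R[r] := M[R[a]] *)
| Write (a r : nat)              (* M[R[a]] := R[r] *)
| JumpZ (r l : nat)              (* if R[r] = 0 then goto l *)
| Halt (answer : bool).

Definition program : Type := list instr.

Record config : Type := Config {
  pc : nat;
  reg : nat -> nat;
  mem : nat -> nat
}.

Definition update (f : nat -> nat) (i v : nat) : nat -> nat :=
  fun j => if j =? i then v else f j.

(** Halted configurations are fixed points.  A run whose program counter
    leaves the program is stuck as well, but gives no answer. *)
Definition step (P : program) (c : config) : config :=
  match nth_error P (pc c) with
  | Some (Const r v) => Config (S (pc c)) (update (reg c) r v) (mem c)
  | Some (Op o r a b) =>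
      Config (S (pc c))
        (update (reg c) r (eval_binop o (reg c a) (reg c b))) (mem c)
  | Some (Read r a) =>
      Config (S (pc c)) (update (reg c) r (mem c (reg c a))) (mem c)
  | Some (Write a r) =>
      Config (S (pc c)) (reg c) (update (mem c) (reg c a) (reg c r))
  | Some (JumpZ r l) =>
      Config (if reg c r =? 0 then l else S (pc c)) (reg c) (mem c)
  | Some (Halt _) | None => c
  end.

Definition run (P : program) (t : nat) (c : config) : config :=
  Nat.iter t (step P) c.

Definition answers (P : program) (c : config) (b : bool) : Prop :=
  nth_error P (pc c) = Some (Halt b).

(** Addresses need no separate bound, being register contents. *)
Definition fits (w : nat) (c : config) : Prop :=
  (forall r : nat, reg c r < 2 ^ w) /\ (forall a : nat, mem c a < 2 ^ w).

(** * Algorithms for k-AP detection *)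

(** The input is [N] in register [0] and the characteristic vector of [A] in
    memory; every other register and cell is [0]. *)
Definition input (N : nat) (A : nat -> bool) : config :=
  Config 0 (update (fun _ => 0) 0 N) (fun a => Nat.b2n (A a)).

Definition subset_upto (N : nat) (A : nat -> bool) : Prop :=
  forall a : nat, A a = true -> a <= N.

(** The word length is [c * (1 + log2 N)] for a constant [c] chosen by the
    algorithm, i.e. [O(log N)]; the [1 +] handles [N <= 1]. *)
Definition decides_kAP (k : nat) (P : program) (T : nat -> nat) : Prop :=
  exists c : nat, forall (N : nat) (A : nat -> bool), subset_upto N A ->
    (forall t : nat, fits (c * (1 + Nat.log2 N)) (run P t (input N A))) /\
    exists b : bool,
      answers P (run P (T N) (input N A)) b /\ (b = true <-> has_kAP k A).

Definition bigO_pow (T : nat -> nat) (s : R) : Prop :=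
  exists (C : R) (N0 : nat), forall N : nat, N0 <= N ->
    (INR (T N) <= C * Rpower (INR N) s)%R.

Definition kAP_hypothesis (k : nat) : Prop :=
  forall eps : R, (0 < eps)%R ->
    ~ exists (P : program) (T : nat -> nat),
        decides_kAP k P T /\ bigO_pow T (2 - eps)%R.

(* Main.v *)
Require Import Defs.
From Stdlib Require Import Reals ZArith Arith List Bool Lia Lra.
Import Defs ListNotations.

(** It suffices to pass from [k] to [k + 1].  Given [A] inside [{0..N}], place
    copies of [A] in [k] regions of length [L = 4N + 1] and a filler set in a
    region number [k].  If the filler contains no 3-AP, a [(k+1)]-AP with small
    difference lies in one copy of [A], while one with large difference has
    exactly one term in each region, so that its first [k] terms project to a
    [k]-AP of [A].  This projection is nontrivial because the first two copies
    keep only the numbers whose [l]-th bit is 0, respectively 1.  Conversely a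
    [k]-AP of [A] lifts to a [(k+1)]-AP for some [l] and some filler containing
    its next term.  The fillers are Behrend-type colour classes: with [t]
    digits in base [2q], [(2q)^t > 2N], fix the sum of the squares of the lower
    halves of the digits and all upper halves.  There are
    [O(q^3) = O(N^(3/t))] choices of filler and bit, which for a large constant
    [t] is absorbed by the saving in the exponent.

    On the word RAM, every choice runs the given program in a fresh segment of
    the memory, so that nothing has to be erased between two runs. *)

(** * Colour classes without 3-term progressions *)

(** A digit in base [2 * q] splits as [q * h + r] with [h] in {0, 1} and [r < q]. For the lowest
    digit of [n] the lower half [r] is [n mod q]. *)
Fixpoint square_sum (q t n : nat) : nat :=
  match t with
  | 0 => 0
  | S t' => (n mod q) * (n mod q) + square_sum q t' (n / (2 * q))
  end.

(** [(n / q) mod 2] is the upper half [h] of the lowest digit; the [t] upper halves are packed as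
    the bits of one number. *)
Fixpoint high_bits (q t n : nat) : nat :=
  match t with
  | 0 => 0
  | S t' => (n / q) mod 2 + 2 * high_bits q t' (n / (2 * q))
  end.

(** An injective pairing: the sum of squares is below [t * q * q], so it is recovered as the
    remainder and the upper halves as the quotient. *)
Definition color (q t n : nat) : nat :=
  square_sum q t n + t * q * q * high_bits q t n.

Lemma square_sum_le q t n : 1 <= q -> square_sum q t n <= t * ((q - 1) * (q - 1)).
Proof.
  intros hq; revert n; induction t as [|t IH]; intros n; cbn [square_sum]; [lia|].
  specialize (IH (n / (2 * q))).
  assert (h : n mod q <= q - 1) by (pose proof (Nat.mod_upper_bound n q); lia).
  pose proof (Nat.mul_le_mono _ _ _ _ h h); lia.
Qed.

Lemma square_sum_lt q t n : 1 <= q -> 1 <= t -> square_sum q t n < t * q * q.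
Proof.
  intros hq ht; pose proof (square_sum_le q t n hq).
  enough (t * ((q - 1) * (q - 1)) < t * q * q) by lia.
  destruct q as [|q]; [lia|]. replace (S q - 1) with q by lia. nia.
Qed.

Lemma high_bits_lt q t n : high_bits q t n < 2 ^ t.
Proof.
  revert n; induction t as [|t IH]; intros n; cbn [high_bits]; [simpl; lia|].
  specialize (IH (n / (2 * q))); rewrite Nat.pow_succ_r'.
  pose proof (Nat.mod_upper_bound (n / q) 2); lia.
Qed.

Lemma color_lt q t n : 1 <= q -> 1 <= t -> color q t n < t * q * q * 2 ^ t.
Proof.
  intros hq ht; unfold color.
  pose proof (square_sum_lt q t n hq ht); pose proof (high_bits_lt q t n).
  nia.
Qed.

Lemma color_inj q t m n : 1 <= q -> 1 <= t -> color q t m = color q t n ->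
  square_sum q t m = square_sum q t n /\ high_bits q t m = high_bits q t n.
Proof.
  intros hq ht h; unfold color in h.
  pose proof (square_sum_lt q t n hq ht); pose proof (square_sum_lt q t m hq ht).
  destruct (Nat.div_mod_unique (t * q * q) (high_bits q t m) (high_bits q t n)
    (square_sum q t m) (square_sum q t n)); lia.
Qed.

Lemma base_decomp q n : 1 <= q ->
  n = 2 * q * (n / (2 * q)) + q * ((n / q) mod 2) + n mod q.
Proof.
  intros hq.
  rewrite (Nat.mul_comm 2 q), <- Nat.Div0.div_div.
  pose proof (Nat.div_mod_eq n q); pose proof (Nat.div_mod_eq (n / q) 2); nia.
Qed.

Lemma digit_unique Q U V r s : r < Q -> s < Q -> Q * U + r = Q * V + s -> U = V /\ r = s.
Proof. intros; apply (Nat.div_mod_unique Q); trivial. Qed.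

(** With [a = b - e] and [c = b + e] the two sides differ by [2 * e * e]. *)
Lemma square_convex a b c : a + c = 2 * b ->
  2 * (b * b) <= a * a + c * c /\ (2 * (b * b) = a * a + c * c -> a = b).
Proof.
  intros h; assert (c = 2 * b - a) as -> by lia.
  destruct (le_lt_dec a b) as [l|l].
  - replace b with (a + (b - a)) by lia. generalize (b - a) as d; intros d.
    replace (2 * (a + d) - a) with (a + 2 * d) by lia. split; nia.
  - replace a with (b + (a - b)) in * by lia. revert h. generalize (a - b) as d; intros d h.
    assert (exists e, b = d + e) as [e ->] by (exists (b - d); lia).
    replace (2 * (d + e) - (d + e + d)) with e by lia. split; nia.
Qed.

(* Fixing the high halves of the digits excludes carries, so a 3-AP is a 3-AP
   in every low digit, and the square is strictly convex. *)
Lemma square_sum_convex q t x y z : 1 <= q ->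
  x < (2 * q) ^ t -> y < (2 * q) ^ t -> z < (2 * q) ^ t -> x + z = 2 * y ->
  high_bits q t x = high_bits q t y -> high_bits q t z = high_bits q t y ->
  2 * square_sum q t y <= square_sum q t x + square_sum q t z /\
  (2 * square_sum q t y = square_sum q t x + square_sum q t z -> x = y).
Proof.
  intros hq; revert x y z; induction t as [|t IH]; intros x y z.
  - simpl; lia.
  - cbn [high_bits square_sum]; intros hx hy hz hap h1 h2.
    assert (hb : forall n, n < (2 * q) ^ S t -> n / (2 * q) < (2 * q) ^ t).
    { intros n hn; apply Nat.Div0.div_lt_upper_bound; exact hn. }
    apply hb in hx, hy, hz; clear hb.
    pose proof (base_decomp q x hq) as dx; pose proof (base_decomp q y hq) as dy.
    pose proof (base_decomp q z hq) as dz.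
    pose proof (Nat.mod_upper_bound (x / q) 2); pose proof (Nat.mod_upper_bound (y / q) 2).
    pose proof (Nat.mod_upper_bound (z / q) 2).
    pose proof (Nat.mod_upper_bound x q); pose proof (Nat.mod_upper_bound y q).
    pose proof (Nat.mod_upper_bound z q).
    set (X := x / (2 * q)) in *; set (Y := y / (2 * q)) in *; set (Z := z / (2 * q)) in *.
    assert (e1 : (x / q) mod 2 = (y / q) mod 2 /\ high_bits q t X = high_bits q t Y) by lia.
    assert (e2 : (z / q) mod 2 = (y / q) mod 2 /\ high_bits q t Z = high_bits q t Y) by lia.
    destruct e1 as [e1 e1'], e2 as [e2 e2']; rewrite e1 in dx; rewrite e2 in dz.
    set (hh := (y / q) mod 2) in *.
    set (a := x mod q) in *; set (b := y mod q) in *; set (c := z mod q) in *.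
    destruct (digit_unique (2 * q) (X + Z) (2 * Y) (a + c) (2 * b)) as [eq1 eq2]; [lia..|].
    destruct (IH X Y Z hx hy hz eq1 e1' e2') as [i1 i2].
    destruct (square_convex a b c eq2) as [s1 s2].
    split; [lia|]. intros hs.
    assert (a = b) by (apply s2; lia).
    assert (X = Y) by (apply i2; lia). congruence.
Qed.

(** Within one class the three sums of squares agree, which is the equality case of the
    convexity. *)
Lemma color_class_3AP_free q t x y z : 1 <= q -> 1 <= t ->
  x < (2 * q) ^ t -> y < (2 * q) ^ t -> z < (2 * q) ^ t -> x + z = 2 * y ->
  color q t x = color q t y -> color q t z = color q t y -> x = y.
Proof.
  intros hq ht hx hy hz hap h1 h2.
  apply color_inj in h1, h2; trivial.
  destruct h1 as [h1 h1'], h2 as [h2 h2'].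
  apply (square_sum_convex q t x y z); trivial; lia.
Qed.

(** If the halves agree, the lowest bits differ; otherwise the halves are again strictly ordered.
    Such a bit tells the first two terms of a progression apart. *)
Lemma separating_bit x y : x < y ->
  exists l, 2 ^ l <= y /\ (x / 2 ^ l) mod 2 = 0 /\ (y / 2 ^ l) mod 2 = 1.
Proof.
  revert x; induction y as [y IH] using lt_wf_ind; intros x hxy.
  pose proof (Nat.div_mod_eq x 2); pose proof (Nat.div_mod_eq y 2).
  pose proof (Nat.mod_upper_bound x 2); pose proof (Nat.mod_upper_bound y 2).
  destruct (Nat.eq_dec (x / 2) (y / 2)) as [e|e].
  - exists 0. simpl (2 ^ 0). rewrite !Nat.div_1_r. lia.
  - destruct (IH (y / 2) ltac:(lia) (x / 2) ltac:(lia)) as (l & h1 & h2 & h3).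
    exists (S l). rewrite Nat.pow_succ_r', <- !Nat.Div0.div_div.
    repeat split; trivial. lia.
Qed.

(** * The instances with k + 1 terms *)

(** Occupied offsets are at most [2 * N]: a jump of at most [2 * N] cannot cross the empty rest of a
    region, and a longer one cannot stay among its occupied offsets. *)
Definition block (N : nat) : nat := 4 * N + 1.

(** The last region also reaches offset [2 * N], since the term following a progression in {0..N}
    may be that large. *)
Definition top (k N : nat) : nat := k * block N + 2 * N.

(** In regions 0 and 1 the region index itself is the value required of bit [l] of the offset. *)
Definition cell (k t N q : nat) (A : nat -> bool) (l c p : nat) : bool :=
  ((p / block N <? k) && A (p mod block N) &&
     ((1 <? p / block N) || (p / block N =? (p mod block N / 2 ^ l) mod 2)))
  || ((p / block N =? k) && (color q t (p mod block N) =? c)).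

(** The cut at [top k N] keeps the offsets in the filler at most [2 * N]. *)
Definition instance (k t N q : nat) (A : nat -> bool) (l c p : nat) : bool :=
  (p <=? top k N) && cell k t N q A l c p.

Lemma instance_subset k t N q A l c : subset_upto (top k N) (instance k t N q A l c).
Proof.
  intros p hp; unfold instance in hp; apply andb_true_iff in hp; destruct hp as [hp _].
  now apply Nat.leb_le.
Qed.

Lemma has_kAP_ascending k A : has_kAP k A -> 1 <= k ->
  exists x d : nat, 1 <= d /\ forall i, i < k -> A (x + i * d) = true.
Proof.
  intros (x & d & hd & h) hk.
  destruct (Z_lt_le_dec 0 d) as [pos|neg].
  - destruct (h 0 ltac:(lia)) as (a & ha & ea).
    exists a, (Z.to_nat d); split; [lia|]. intros i hi.
    destruct (h i hi) as (b & hb & eb). replace (a + i * Z.to_nat d) with b; trivial.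
    apply Nat2Z.inj. rewrite Nat2Z.inj_add, Nat2Z.inj_mul, Z2Nat.id; lia.
  (* A negative difference: the progression is read from its last term. *)
  - destruct (h (k - 1) ltac:(lia)) as (a & ha & ea).
    exists a, (Z.to_nat (- d)); split; [lia|]. intros i hi.
    destruct (h (k - 1 - i) ltac:(lia)) as (b & hb & eb).
    replace (a + i * Z.to_nat (- d)) with b; trivial.
    apply Nat2Z.inj. rewrite Nat2Z.inj_add, Nat2Z.inj_mul, Z2Nat.id by lia.
    rewrite Nat2Z.inj_sub in eb by lia. rewrite ea, eb. ring.
Qed.

Lemma ascending_has_kAP k A (x d : nat) : 1 <= d ->
  (forall i, i < k -> A (x + i * d) = true) -> has_kAP k A.
Proof.
  intros hd h. exists (Z.of_nat x), (Z.of_nat d). split; [lia|].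
  intros i hi. exists (x + i * d). split; [now apply h|lia].
Qed.

Lemma block_divmod N i o : o < block N ->
  (i * block N + o) / block N = i /\ (i * block N + o) mod block N = o.
Proof.
  intros ho. assert (block N <> 0) by (unfold block; lia).
  rewrite (Nat.add_comm (i * _)), Nat.div_add, Nat.Div0.mod_add by trivial.
  rewrite Nat.div_small, Nat.mod_small by trivial. lia.
Qed.

(** Enlarging the difference by [block N] puts term [i] into region [i] at its old offset. The
    filler is the colour class of the next term [x + k * d]. *)
Lemma instance_complete k t N q A : 2 <= k -> 1 <= t -> 1 <= q -> subset_upto N A ->
  has_kAP k A -> exists l c, 2 ^ l <= N /\ c < t * q * q * 2 ^ t /\
    has_kAP (S k) (instance k t N q A l c).
Proof.
  intros hk ht hq hA h.
  destruct (has_kAP_ascending k A h) as (x & d & hd & hx); [lia|].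
  assert (hN : forall i, i < k -> x + i * d <= N) by (intros i hi; apply hA; auto).
  destruct (separating_bit x (x + 1 * d)) as (l & h1 & h2 & h3); [lia|].
  pose proof (hN 1 ltac:(lia)); pose proof (hN (k - 1) ltac:(lia)) as hl.
  exists l, (color q t (x + k * d)). split; [lia|]. split; [now apply color_lt|].
  (* As [k >= 2], the first two terms give [d <= N], so the next term is at most
     [N + d <= 2 * N]. *)
  assert (hk' : x + k * d <= 2 * N) by nia.
  apply (ascending_has_kAP _ _ x (block N + d)); [lia|].
  intros i hi. replace (x + i * (block N + d)) with (i * block N + (x + i * d)) by lia.
  assert (ho : x + i * d <= 2 * N) by nia.
  destruct (block_divmod N i (x + i * d)) as [e1 e2]; [unfold block; lia|].
  unfold instance, cell. rewrite e1, e2.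
  apply andb_true_iff; split.
  { apply Nat.leb_le; unfold top. assert (i * block N <= k * block N) by (apply Nat.mul_le_mono_r; lia).
    lia. }
  apply orb_true_iff. destruct (Nat.eq_dec i k) as [->|ne].
  - right. now rewrite !Nat.eqb_refl.
  - left. rewrite hx by lia. rewrite (proj2 (Nat.ltb_lt i k)) by lia.
    rewrite andb_true_l.
    destruct i as [|[|i]]; [| |reflexivity]; apply orb_true_iff; right; apply Nat.eqb_eq.
    + now replace (x + 0 * d) with x by lia.
    + now symmetry.
Qed.

Lemma strictly_increasing_ge (f : nat -> nat) n :
  (forall i, i < n -> f i < f (S i)) -> forall i, i <= n -> i + f 0 <= f i.
Proof.
  intros h i; induction i as [|i IH]; intros hi; [lia|].
  specialize (h i ltac:(lia)); specialize (IH ltac:(lia)); lia.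
Qed.

(** Offsets lie in an interval of length [W] and regions are more than [2 * W] apart, so comparing
    [d] with [W] decides whether the region index changes. *)
Lemma near_terms L W u v r s d : 2 * W < L -> r <= W -> s <= W ->
  L * v + s = L * u + r + d -> (d <= W -> u = v) /\ (W < d -> u < v).
Proof.
  intros hL hr hs h; split; intros hd.
  - destruct (Nat.lt_trichotomy u v) as [g|[g|g]]; trivial; exfalso.
    + pose proof (Nat.mul_le_mono_l (S u) v L g); lia.
    + pose proof (Nat.mul_le_mono_l (S v) u L g); lia.
  - destruct (le_lt_dec v u) as [g|g]; trivial.
    pose proof (Nat.mul_le_mono_l v u L g); lia.
Qed.

Lemma instance_sound k t N q A l c : 2 <= k -> 1 <= t -> 1 <= q ->
  2 * N < (2 * q) ^ t -> subset_upto N A ->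
  has_kAP (S k) (instance k t N q A l c) -> has_kAP k A.
Proof.
  intros hk ht hq hqt hA h.
  destruct (has_kAP_ascending _ _ h) as (x & d & hd & hx); [lia|]; clear h.
  set (L := block N) in *. assert (hL : L = 4 * N + 1) by reflexivity.
  set (p := fun i => x + i * d).
  assert (hp : forall i, i <= k ->
    (p i / L < k /\ A (p i mod L) = true /\
      (1 < p i / L \/ p i / L = (p i mod L / 2 ^ l) mod 2))
    \/ (p i / L = k /\ color q t (p i mod L) = c /\ p i mod L <= 2 * N)).
  { intros i hi. specialize (hx i ltac:(lia)). fold (p i) in hx.
    unfold instance, cell in hx. fold L in hx.
    apply andb_true_iff in hx; destruct hx as [hx1 hx].
    apply Nat.leb_le in hx1. unfold top in hx1; fold L in hx1.
    apply orb_true_iff in hx; destruct hx as [hx|hx]; [left|right].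
    - apply andb_true_iff in hx; destruct hx as [hx hx2].
      apply andb_true_iff in hx; destruct hx as [hx hx3].
      apply Nat.ltb_lt in hx. repeat split; trivial.
      apply orb_true_iff in hx2; destruct hx2 as [hx2|hx2];
        [left; now apply Nat.ltb_lt|right; now apply Nat.eqb_eq].
    - apply andb_true_iff in hx; destruct hx as [hx hx2].
      apply Nat.eqb_eq in hx, hx2. repeat split; trivial.
      pose proof (Nat.div_mod_eq (p i) L) as e. rewrite hx in e.
      rewrite e in hx1 at 1. lia. }
  assert (ho : forall i, i <= k -> p i mod L <= 2 * N).
  { intros i hi. destruct (hp i hi) as [(_ & a & _)|(_ & _ & a)]; trivial. apply hA in a. lia. }
  assert (hpL : forall i, p i = L * (p i / L) + p i mod L) by (intros; apply Nat.div_mod_eq).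
  assert (hS : forall i, p (S i) = p i + d) by (intros; unfold p; lia).
  destruct (le_lt_dec d (2 * N)) as [small|large].
  - (* a difference at most 2N cannot jump the gap between two regions *)
    assert (same : forall i, i <= k -> p i / L = p 0 / L /\ p i mod L = p 0 mod L + i * d).
    { induction i as [|i IH]; intros hi; [lia|].
      destruct (IH ltac:(lia)) as [e1 e2].
      pose proof (hpL i) as a1; pose proof (hpL (S i)) as a2; rewrite hS in a2 at 1.
      pose proof (ho i ltac:(lia)); pose proof (ho (S i) ltac:(lia)).
      assert (g : p i / L = p (S i) / L) by (apply (near_terms L (2 * N) _ _ (p i mod L) (p (S i) mod L) d); lia).
      split; [congruence|]. rewrite <- g in a2. lia. }
    destruct (hp 0 ltac:(lia)) as [(a1 & a2 & _)|(a1 & a2 & a3)].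
    + apply (ascending_has_kAP _ _ (p 0 mod L) d hd).
      intros i hi. destruct (same i ltac:(lia)) as [s1 s2].
      destruct (hp i ltac:(lia)) as [(b1 & b2 & _)|(b1 & _)]; [now rewrite <- s2|lia].
    + exfalso.
      (* [k >= 2] supplies three terms, all in the filler, where a 3-AP is impossible. *)
      destruct (same 1 ltac:(lia)) as [s1 s1'], (same 2 ltac:(lia)) as [s2 s2'].
      destruct (hp 1 ltac:(lia)) as [(b1 & _)|(b1 & b2 & b3)]; [lia|].
      destruct (hp 2 ltac:(lia)) as [(g1 & _)|(g1 & g2 & g3)]; [lia|].
      assert (p 0 mod L = p 1 mod L); [|lia].
      apply (color_class_3AP_free q t _ _ (p 2 mod L)); lia.
  - (* otherwise each of the k + 1 regions holds exactly one term *)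
    assert (up : forall i, i < k -> p i / L < p (S i) / L).
    { intros i hi. pose proof (hpL i) as a1; pose proof (hpL (S i)) as a2; rewrite hS in a2 at 1.
      pose proof (ho i ltac:(lia)); pose proof (ho (S i) ltac:(lia)).
      apply (near_terms L (2 * N) _ _ (p i mod L) (p (S i) mod L) d); lia. }
    (* The indices grow strictly along [k + 1] terms and stay in {0..k}, so none is skipped. *)
    assert (idx : forall i, i <= k -> p i / L = i).
    { intros i hi.
      pose proof (strictly_increasing_ge (fun i => p i / L) k up i hi) as g; cbv beta in g.
      assert (hi' : forall j, j <= k - i -> p i / L + j <= p (i + j) / L).
      { induction j as [|j IH]; intros hj; [rewrite !Nat.add_0_r; lia|].
        specialize (IH ltac:(lia)). specialize (up (i + j) ltac:(lia)).
        rewrite !Nat.add_succ_r. lia. }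
      specialize (hi' (k - i) ltac:(lia)). replace (i + (k - i)) with k in hi' by lia.
      destruct (hp k ltac:(lia)) as [(b & _)|(b & _)]; lia. }
    (* Removing [i * L] from term [i] leaves its offset. The new difference may be negative. It is
       not 0, since then the first two offsets would coincide while their bits [l] are 0 and 1. *)
    exists (Z.of_nat x), (Z.of_nat d - Z.of_nat L)%Z. split.
    + intros e. assert (p 1 = p 0 + L) by (unfold p; lia).
      assert (e1 : p 1 mod L = p 0 mod L).
      { pose proof (hpL 0) as b0; pose proof (hpL 1) as b1.
        rewrite (idx 0) in b0 by lia; rewrite (idx 1) in b1 by lia. lia. }
      destruct (hp 0 ltac:(lia)) as [(_ & _ & f0)|(f0 & _)]; rewrite (idx 0) in f0 by lia; [|lia].
      destruct (hp 1 ltac:(lia)) as [(_ & _ & f1)|(f1 & _)]; rewrite (idx 1) in f1 by lia; [|lia].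
      rewrite e1 in f1. lia.
    + intros i hi. exists (p i mod L). split.
      * destruct (hp i ltac:(lia)) as [(_ & f & _)|(f & _)]; [exact f|].
        rewrite idx in f; lia.
      * pose proof (hpL i) as b. rewrite (idx i) in b by lia. unfold p at 1 in b. lia.
Qed.

(** * Enumeration of the choices of bit and filler *)

Definition colors (t q : nat) : nat := t * q * q * 2 ^ t.

(** Since [N < (2 * q) ^ t <= 2 ^ (2 * q * t)], the factor [2 * q * t] covers all bit positions
    without computing a logarithm. *)
Definition rounds (t q : nat) : nat := colors t q * (2 * q * t).

Definition round_instance (k t N q : nat) (A : nat -> bool) (j : nat) : nat -> bool :=
  instance k t N q A (j / colors t q) (j mod colors t q).

Lemma round_instances_correct k t N q A : 2 <= k -> 1 <= t -> 1 <= q ->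
  2 * N < (2 * q) ^ t -> subset_upto N A ->
  (exists j, j < rounds t q /\ has_kAP (S k) (round_instance k t N q A j)) <-> has_kAP k A.
Proof.
  intros hk ht hq hqt hA; split.
  - intros (j & _ & h). exact (instance_sound _ _ _ _ _ _ _ hk ht hq hqt hA h).
  - intros h. destruct (instance_complete k t N q A) as (l & c & hl & hc & h'); trivial.
    fold (colors t q) in hc.
    assert (l < 2 * q * t).
    { assert (hh : (2 * q) ^ t <= (2 ^ (2 * q)) ^ t).
      { apply Nat.pow_le_mono_l. apply Nat.lt_le_incl, Nat.pow_gt_lin_r. lia. }
      rewrite <- Nat.pow_mul_r in hh.
      apply (Nat.pow_lt_mono_r_iff 2); lia. }
    exists (l * colors t q + c). split.
    + unfold rounds. nia.
    + unfold round_instance.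
      rewrite (Nat.add_comm (l * _)), Nat.div_add, Nat.Div0.mod_add by lia.
      rewrite Nat.div_small, Nat.mod_small by trivial. exact h'.
Qed.

(** * A structured language compiled to the word RAM *)

Inductive expr : Type :=
| Var (r : nat)
| Cst (v : nat)
| Bin (o : binop) (a b : expr)
| Rd (a : expr).

Fixpoint ev (e : expr) (R M : nat -> nat) : nat :=
  match e with
  | Var r => R r
  | Cst v => v
  | Bin o a b => eval_binop o (ev a R M) (ev b R M)
  | Rd a => M (ev a R M)
  end.

(** Registers from [d] upwards form a stack of intermediate results. [And] of a register with itself
    serves as a copy instruction. *)
Fixpoint comp (e : expr) (d : nat) : list instr :=
  match e with
  | Var r => [Op And d r r]
  | Cst v => [Const d v]
  | Bin o a b => comp a d ++ comp b (S d) ++ [Op o d d (S d)]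
  | Rd a => comp a d ++ [Read d d]
  end.

(** An exponent: with variables and memory below [X >= 2], the value is below [X ^ esize e]. A
    constant [v] counts [S v] because [v < 2 ^ S v]. *)
Fixpoint esize (e : expr) : nat :=
  match e with
  | Var _ => 1
  | Cst v => S v
  | Bin _ a b => esize a + esize b
  | Rd a => esize a
  end.

Definition arith_op (o : binop) : bool :=
  match o with
  | Add | Sub | Mul | Div | Mod | Shr | Eqb | Ltb => true
  | And | Or | Xor | Shl => false
  end.

Fixpoint eok (d : nat) (e : expr) : Prop :=
  match e with
  | Var r => r < d
  | Cst _ => True
  | Bin o a b => arith_op o = true /\ eok d a /\ eok d b
  | Rd a => eok d a
  end.

(** [Raw] receives its start address; it embeds the simulated program, whose jumps are absolute. *)
Inductive stmt : Type :=
| Asg (x : nat) (e : expr)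
| Sto (a v : expr)
| Seq (s1 s2 : stmt)
| Whl (x : nat) (s : stmt)
| Raw (code : nat -> list instr).

(* [d] is the first register available for intermediate results, [o] the
   address of the first instruction. *)
Fixpoint gen (d o : nat) (s : stmt) : list instr :=
  match s with
  | Asg x e => comp e d ++ [Op And x d d]
  | Sto a v => comp a d ++ comp v (S d) ++ [Write d (S d)]
  | Seq s1 s2 => gen d o s1 ++ gen d (o + length (gen d o s1)) s2
  | Whl x s1 =>
      JumpZ x (o + length (gen d (S o) s1) + 3) ::
      gen d (S o) s1 ++ [Const d 0; JumpZ d o]
  | Raw code => code o
  end.

Fixpoint sok (d : nat) (s : stmt) : Prop :=
  match s with
  | Asg x e => x < d /\ eok d e
  | Sto a v => eok d a /\ eok d v
  | Seq s1 s2 => sok d s1 /\ sok d s2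
  | Whl x s1 => x < d /\ sok d s1
  | Raw _ => True
  end.

Fixpoint ssize (s : stmt) : nat :=
  match s with
  | Asg x e => esize e
  | Sto a v => esize a + esize v
  | Seq s1 s2 => ssize s1 + ssize s2
  | Whl x s1 => ssize s1
  | Raw _ => 0
  end.

(** * Runs with bounded time and bounded contents *)

Definition code_at (Q : program) (o : nat) (l : list instr) : Prop :=
  forall i ins, nth_error l i = Some ins -> nth_error Q (o + i) = Some ins.

Lemma code_at_app Q o l l' : code_at Q o (l ++ l') ->
  code_at Q o l /\ code_at Q (o + length l) l'.
Proof.
  intros h; split; intros i ins hi.
  - apply h. rewrite nth_error_app1; trivial. apply nth_error_Some; congruence.
  - rewrite <- Nat.add_assoc. apply h. rewrite nth_error_app2 by lia.
    now replace (length l + i - length l) with i by lia.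
Qed.

Lemma code_at_cons Q o x l : code_at Q o (x :: l) ->
  nth_error Q o = Some x /\ code_at Q (S o) l.
Proof.
  intros h; split.
  - rewrite <- (Nat.add_0_r o). now apply h.
  - intros i ins hi. rewrite Nat.add_succ_comm. now apply h.
Qed.

Definition below (B : nat) (c : config) : Prop :=
  (forall r, reg c r < B) /\ (forall a, mem c a < B).

(** Only variables and memory must stay below [X]; scratch registers from [d] on may hold larger
    intermediate results. *)
Definition bounded (X d : nat) (R M : nat -> nat) : Prop :=
  (forall y, y < d -> R y < X) /\ (forall a, M a < X).

(** The size bound covers every intermediate configuration because [fits] is required throughout a
    run. *)
Definition reach (Q : program) (B T : nat) (c : config) (Post : config -> Prop) : Prop :=
  exists n, n <= T /\ (forall t, t <= n -> below B (run Q t c)) /\ Post (run Q n c).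

Lemma run_add Q n m c : run Q (n + m) c = run Q m (run Q n c).
Proof. unfold run. rewrite Nat.add_comm. apply Nat.iter_add. Qed.

Lemma reach_here Q B T c (Post : config -> Prop) : below B c -> Post c -> reach Q B T c Post.
Proof.
  intros hb hp. exists 0. split; [lia|]. split; trivial.
  intros t ht. now replace t with 0 by lia.
Qed.

Lemma reach_start Q B T c Post : reach Q B T c Post -> below B c.
Proof. intros (n & _ & h & _). exact (h 0 ltac:(lia)). Qed.

Lemma reach_bind Q B T1 T2 T c Post1 Post : reach Q B T1 c Post1 -> T1 + T2 <= T ->
  (forall c1, below B c1 -> Post1 c1 -> reach Q B T2 c1 Post) -> reach Q B T c Post.
Proof.
  intros (n1 & h1 & f1 & p1) hT h.
  destruct (h _ (f1 n1 (le_n _)) p1) as (n2 & h2 & f2 & p2).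
  exists (n1 + n2). split; [lia|]. split; [|now rewrite run_add].
  intros t ht. destruct (le_lt_dec t n1) as [l|l]; [now apply f1|].
  replace t with (n1 + (t - n1)) by lia. rewrite run_add. apply f2. lia.
Qed.

Lemma reach_step Q B T c Post : below B c ->
  reach Q B T (step Q c) Post -> reach Q B (S T) c Post.
Proof.
  intros hb h. apply (reach_bind Q B 1 T _ _ (fun c' => c' = step Q c)).
  - exists 1. split; [lia|]. split; [|reflexivity].
    intros [|[|t]] ht; [exact hb|exact (reach_start _ _ _ _ _ h)|lia].
  - lia.
  - now intros c1 _ ->.
Qed.

Lemma reach_mono Q B T T' c (Post Post' : config -> Prop) : reach Q B T c Post -> T <= T' ->
  (forall c', below B c' -> Post c' -> Post' c') -> reach Q B T' c Post'.
Proof.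
  intros (n & h1 & f & p) hT h. exists n. split; [lia|]. split; auto.
Qed.

Lemma update_eq f i v : update f i v i = v.
Proof. unfold update. now rewrite Nat.eqb_refl. Qed.

Lemma update_neq f i v j : j <> i -> update f i v j = f j.
Proof. intros h. unfold update. now rewrite (proj2 (Nat.eqb_neq j i) h). Qed.

Lemma update_lt f i v j B : f j < B -> v < B -> update f i v j < B.
Proof. intros. unfold update. now destruct (j =? i). Qed.

Lemma below_reg B c p r v : below B c -> v < B ->
  below B (Config p (update (reg c) r v) (mem c)).
Proof. intros [h1 h2] hv. split; simpl; trivial. intros. now apply update_lt. Qed.

Lemma below_mem B c p a v : below B c -> v < B ->
  below B (Config p (reg c) (update (mem c) a v)).
Proof. intros [h1 h2] hv. split; simpl; trivial. intros. now apply update_lt. Qed.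

Lemma b2n_le b : Nat.b2n b <= 1.
Proof. destruct b; simpl; lia. Qed.

Lemma eval_binop_lt o X x y m n : arith_op o = true -> 2 <= X -> 1 <= m -> 1 <= n ->
  x < X ^ m -> y < X ^ n -> eval_binop o x y < X ^ (m + n).
Proof.
  intros ho hX hm hn hx hy. rewrite Nat.pow_add_r.
  assert (2 <= X ^ m) by (rewrite <- (Nat.pow_1_r 2); transitivity (X ^ 1);
    [now rewrite !Nat.pow_1_r|apply Nat.pow_le_mono_r; lia]).
  assert (2 <= X ^ n) by (rewrite <- (Nat.pow_1_r 2); transitivity (X ^ 1);
    [now rewrite !Nat.pow_1_r|apply Nat.pow_le_mono_r; lia]).
  set (a := X ^ m) in *; set (b := X ^ n) in *; clearbody a b.
  assert (a <= a * b) by nia.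
  assert (2 <= a * b) by lia.
  destruct o; try discriminate ho; cbn [eval_binop].
  - nia.
  - lia.
  - apply Nat.mul_lt_mono; trivial.
  - pose proof (Nat.Div0.div_le_upper_bound x y x). destruct y; [simpl; lia|].
    assert (x / S y <= x) by (apply Nat.Div0.div_le_upper_bound; nia). lia.
  - pose proof (Nat.Div0.mod_le x y). lia.
  - rewrite Nat.shiftr_div_pow2. assert (2 ^ y <> 0) by (apply Nat.pow_nonzero; lia).
    assert (x / 2 ^ y <= x) by (apply Nat.Div0.div_le_upper_bound; nia). lia.
  - pose proof (b2n_le (x =? y)). lia.
  - pose proof (b2n_le (x <? y)). lia.
Qed.

Lemma esize_pos e : 1 <= esize e.
Proof. induction e; simpl; lia. Qed.

Lemma ev_lt X d e R M : 2 <= X -> eok d e -> bounded X d R M -> ev e R M < X ^ esize e.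
Proof.
  intros hX he [hR hM]; induction e as [r|v|o a IHa b IHb|a IHa]; simpl in he; cbn [ev esize].
  - rewrite Nat.pow_1_r. auto.
  - apply Nat.lt_trans with (S v); [lia|]. apply Nat.pow_gt_lin_r. lia.
  - destruct he as (ho & ha & hb). apply eval_binop_lt; auto using esize_pos.
  - apply Nat.lt_le_trans with (X ^ 1); [rewrite Nat.pow_1_r; auto|].
    apply Nat.pow_le_mono_r; [lia|apply esize_pos].
Qed.

Lemma ev_ext d e R R' M : eok d e -> (forall y, y < d -> R y = R' y) -> ev e R M = ev e R' M.
Proof.
  intros he h; induction e as [r|v|o a IHa b IHb|a IHa]; simpl in *; auto.
  destruct he as (_ & ha & hb). now rewrite IHa, IHb.
Qed.

Lemma bounded_ext X d R R' M : (forall y, y < d -> R' y = R y) ->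
  bounded X d R M -> bounded X d R' M.
Proof. intros h [h1 h2]. split; trivial. intros y hy. rewrite h; auto. Qed.

(** * Hoare triples with running time *)

Section Hoare.

Context (X d sz : nat) (hX : 2 <= X).

Let B := X ^ sz.

Lemma size_lt e R M : eok d e -> bounded X d R M -> esize e <= sz -> ev e R M < B.
Proof using hX.
  intros he hb hs. apply Nat.lt_le_trans with (X ^ esize e); [now apply (ev_lt X d)|].
  apply Nat.pow_le_mono_r; lia.
Qed.

(** The stack position [d'] is generalised; registers below it survive, which protects the left
    operand while the right one is evaluated. *)
Lemma comp_reach Q e : forall d' c, code_at Q (pc c) (comp e d') -> below B c -> d <= d' ->
  eok d e -> esize e <= sz -> bounded X d (reg c) (mem c) ->
  reach Q B (length (comp e d')) c (fun c' =>
    pc c' = pc c + length (comp e d') /\ mem c' = mem c /\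
    reg c' d' = ev e (reg c) (mem c) /\ forall y, y < d' -> reg c' y = reg c y).
Proof using hX.
  induction e as [r|v|o a IHa b IHb|a IHa]; intros d' c hc hb hd he hs hbd; cbn [comp] in *;
    pose proof (size_lt _ _ _ he hbd hs) as hv.
  - apply code_at_cons in hc; destruct hc as [hc _]. simpl in hv.
    apply reach_step; trivial. unfold step; rewrite hc; cbn [eval_binop].
    rewrite Nat.land_diag.
    apply reach_here; [now apply below_reg|]. simpl.
    rewrite update_eq. repeat split; [lia|]. intros y hy. apply update_neq; lia.
  - apply code_at_cons in hc; destruct hc as [hc _]. simpl in hv.
    apply reach_step; trivial. unfold step; rewrite hc.
    apply reach_here; [now apply below_reg|]. simpl.
    rewrite update_eq. repeat split; [lia|]. intros y hy. apply update_neq; lia.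
  - apply code_at_app in hc; destruct hc as [hc1 hc].
    apply code_at_app in hc; destruct hc as [hc2 hc3].
    apply code_at_cons in hc3; destruct hc3 as [hc3 _].
    destruct he as (ho & ha & hbo). cbn [esize] in hs. cbn [ev] in hv. rewrite !length_app; simpl length.
    eapply reach_bind; [apply (IHa d'); trivial; lia|apply le_n|].
    intros c1 hb1 (e1 & e2 & e3 & e4); cbv beta.
    assert (e5 : ev b (reg c1) (mem c1) = ev b (reg c) (mem c)).
    { rewrite e2. apply (ev_ext d); trivial. intros; apply e4; lia. }
    eapply reach_bind; [apply (IHb (S d'))|apply le_n|]; trivial; try lia.
    + now rewrite e1.
    + rewrite e2. apply (bounded_ext X d (reg c)); trivial. intros; apply e4; lia.
    + intros c2 hb2 (f1 & f2 & f3 & f4).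
      apply reach_step; trivial. unfold step; rewrite f1, e1, hc3.
      rewrite (f4 d') by lia. rewrite e3, f3, e5.
      apply reach_here; [now apply below_reg|]. simpl.
      rewrite update_eq, f2, e2. repeat split; [lia|]. intros y hy.
      rewrite update_neq, f4, e4; lia.
  - apply code_at_app in hc; destruct hc as [hc1 hc].
    apply code_at_cons in hc; destruct hc as [hc2 _].
    rewrite length_app; simpl length.
    eapply reach_bind; [apply (IHa d'); trivial|apply le_n|].
    intros c1 hb1 (e1 & e2 & e3 & e4).
    apply reach_step; trivial. unfold step; rewrite e1, hc2, e3, e2.
    apply reach_here; [rewrite <- e2 at 2; now apply below_reg|]. simpl.
    rewrite update_eq. repeat split; [lia|]. intros y hy.
    rewrite update_neq, e4; lia.
Qed.

Definition assertion := (nat -> nat) -> (nat -> nat) -> Prop.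

(** [sok] and [ssize] are premises inside the triple, so they are verified once for the whole
    program and not in each rule. *)
Definition hoare (s : stmt) (T : nat) (Pre Post : assertion) : Prop :=
  sok d s -> ssize s <= sz -> forall Q c,
  code_at Q (pc c) (gen d (pc c) s) -> below B c ->
  bounded X d (reg c) (mem c) -> Pre (reg c) (mem c) ->
  reach Q B T c (fun c' => pc c' = pc c + length (gen d (pc c) s) /\
    bounded X d (reg c') (mem c') /\ Post (reg c') (mem c')).

Lemma hoare_conseq s T T' (Pre Pre' Post Post' : assertion) : hoare s T Pre Post ->
  T <= T' -> (forall R M, Pre' R M -> Pre R M) -> (forall R M, Post R M -> Post' R M) ->
  hoare s T' Pre' Post'.
Proof using.
  intros h hT h1 h2 hs hz Q c hc hb hbd hp.
  apply (reach_mono _ _ T _ _ _ _ (h hs hz Q c hc hb hbd (h1 _ _ hp)) hT).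
  intros c' _ (? & ? & ?); auto.
Qed.

Lemma hoare_asg x e (Pre Post : assertion) :
  (forall R M, bounded X d R M -> Pre R M -> ev e R M < X /\
    forall R', R' x = ev e R M -> (forall y, y < d -> y <> x -> R' y = R y) -> Post R' M) ->
  hoare (Asg x e) (length (comp e d) + 1) Pre Post.
Proof using hX.
  intros h [hx he] hz Q c hc hb hbd hp. cbn [gen ssize] in *.
  apply code_at_app in hc; destruct hc as [hc1 hc]. apply code_at_cons in hc; destruct hc as [hc _].
  eapply reach_bind; [now apply (comp_reach Q e d)|apply le_n|].
  intros c1 hb1 (e1 & e2 & e3 & e4).
  destruct (h _ _ hbd hp) as [hv hpost].
  apply reach_step; trivial. unfold step; rewrite e1, hc, e3; cbn [eval_binop].
  rewrite Nat.land_diag.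
  apply reach_here; [apply below_reg; trivial; now apply size_lt|]. simpl.
  rewrite length_app; simpl length.
  assert (k : forall y, y < d -> y <> x -> update (reg c1) x (ev e (reg c) (mem c)) y = reg c y).
  { intros y hy hne. rewrite update_neq, e4; trivial. }
  split; [lia|]. rewrite e2. split; [split|].
  - intros y hy. destruct (Nat.eq_dec y x) as [->|ne]; [now rewrite update_eq|].
    rewrite k; trivial. now apply hbd.
  - apply hbd.
  - apply hpost; trivial. apply update_eq.
Qed.

Lemma hoare_sto a v (Pre Post : assertion) :
  (forall R M, bounded X d R M -> Pre R M -> ev v R M < X /\
    forall R', (forall y, y < d -> R' y = R y) -> Post R' (update M (ev a R M) (ev v R M))) ->
  hoare (Sto a v) (length (comp a d) + (length (comp v (S d)) + 1)) Pre Post.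
Proof using hX.
  intros h [ha hv] hz Q c hc hb hbd hp. cbn [gen ssize] in *.
  apply code_at_app in hc; destruct hc as [hc1 hc].
  apply code_at_app in hc; destruct hc as [hc2 hc]. apply code_at_cons in hc; destruct hc as [hc _].
  eapply reach_bind; [apply (comp_reach Q a d); trivial; lia|apply le_n|].
  intros c1 hb1 (e1 & e2 & e3 & e4).
  assert (e5 : ev v (reg c1) (mem c1) = ev v (reg c) (mem c)).
  { rewrite e2. now apply (ev_ext d). }
  eapply reach_bind; [apply (comp_reach Q v (S d))|apply le_n|]; trivial; try lia.
  - now rewrite e1.
  - rewrite e2. now apply (bounded_ext X d (reg c)).
  - intros c2 hb2 (f1 & f2 & f3 & f4).
    destruct (h _ _ hbd hp) as [hvX hpost].
    apply reach_step; trivial. unfold step; rewrite f1, e1, hc, (f4 d), e3, f3, e5 by lia.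
    apply reach_here; [apply below_mem; trivial; apply size_lt; trivial; lia|]. simpl.
    rewrite !length_app; simpl length. rewrite f2, e2.
    assert (k : forall y, y < d -> reg c2 y = reg c y) by (intros; rewrite f4, e4; lia).
    split; [lia|]. split; [split|].
    + intros y hy. rewrite k; trivial. now apply hbd.
    + intros y. apply update_lt; trivial. apply hbd.
    + now apply hpost.
Qed.

Lemma hoare_seq s1 s2 T1 T2 (Pre Mid Post : assertion) :
  hoare s1 T1 Pre Mid -> hoare s2 T2 Mid Post -> hoare (Seq s1 s2) (T1 + T2) Pre Post.
Proof using hX.
  intros h1 h2 [ho1 ho2] hz Q c hc hb hbd hp. cbn [gen ssize] in *.
  apply code_at_app in hc; destruct hc as [hc1 hc2].
  eapply reach_bind; [apply h1; trivial; lia|apply le_n|].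
  intros c1 hb1 (e1 & hbd1 & p1). rewrite <- e1 in hc2.
  eapply reach_mono; [apply h2; trivial; lia|apply le_n|].
  intros c2 _ (f1 & hbd2 & p2). split; [|now split].
  rewrite f1, e1, length_app. lia.
Qed.

(** [n] counts the remaining iterations. Each adds the test and the two instructions of the back
    jump; the last test adds 1. The back jump overwrites register [d], so the invariant must depend
    only on registers below [d]. *)
Lemma hoare_whl x s Tb (Inv : nat -> assertion) :
  (forall n R M, Inv n R M -> (R x = 0 <-> n = 0)) ->
  (forall n, hoare s Tb (Inv (S n)) (Inv n)) ->
  (forall n R R' M, (forall y, y < d -> R' y = R y) -> Inv n R M -> Inv n R' M) ->
  forall n, hoare (Whl x s) (n * (Tb + 3) + 1) (Inv n) (Inv 0).
Proof using hX.
  intros hx hbody hext n [ho1 ho2] hz Q; induction n as [|n IH]; intros c hc hb hbd hp;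
    cbn [gen ssize] in *; pose proof hc as hc0;
    apply code_at_cons in hc; destruct hc as [hc1 hc];
    apply code_at_app in hc; destruct hc as [hc2 hc];
    apply code_at_cons in hc; destruct hc as [hc3 hc];
    apply code_at_cons in hc; destruct hc as [hc4 hc].
  - apply reach_step; trivial. unfold step; rewrite hc1.
    rewrite (proj2 (hx 0 _ _ hp) eq_refl); simpl.
    apply reach_here; [exact hb|]. simpl. rewrite length_app; simpl. split; [lia|now split].
  - assert (hne : reg c x =? 0 = false).
    { apply Nat.eqb_neq. intros e. apply (hx (S n) _ _ hp) in e. discriminate. }
    replace (S n * (Tb + 3) + 1) with (S (Tb + (2 + (n * (Tb + 3) + 1)))) by lia.
    apply reach_step; trivial. unfold step; rewrite hc1, hne.
    eapply reach_bind; [exact (hbody n ho2 hz Q (Config (S (pc c)) (reg c) (mem c)) hc2 hb hbd hp)|apply le_n|].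
    intros c1 hb1 (e1 & hbd1 & p1); simpl in e1.
    change (S (pc c) + length (gen d (S (pc c)) s)) with
      (S (pc c + length (gen d (S (pc c)) s))) in *.
    assert (0 < B) by (destruct hb as [hb _]; specialize (hb 0); lia).
    simpl plus. apply reach_step; trivial. unfold step; rewrite e1, hc3.
    assert (hb2 : below B (Config (S (S (pc c + length (gen d (S (pc c)) s))))
      (update (reg c1) d 0) (mem c1))) by now apply below_reg.
    apply reach_step; trivial. unfold step; simpl pc; rewrite hc4; simpl.
    rewrite update_eq; simpl.
    assert (hk : forall y, y < d -> update (reg c1) d 0 y = reg c1 y)
      by (intros; apply update_neq; lia).
    exact (IH (Config (pc c) (update (reg c1) d 0) (mem c1)) hc0 hb2
      (bounded_ext X d _ _ _ hk hbd1) (hext n _ _ _ hk p1)).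
Qed.

End Hoare.

(** * Running a program inside another one *)

Definition instr_regs (ins : instr) : nat :=
  match ins with
  | Const r _ => S r
  | Op _ r a b => S (max r (max a b))
  | Read r a | Write a r => S (max r a)
  | JumpZ r _ => S r
  | Halt _ => 0
  end.

Definition num_regs (P : program) : nat := S (list_max (map instr_regs P)).

Lemma instr_regs_le P i ins : nth_error P i = Some ins -> instr_regs ins <= num_regs P.
Proof.
  intros h. unfold num_regs. apply le_S.
  pose proof (proj1 (list_max_le (map instr_regs P) _) (le_n _)) as hf.
  rewrite Forall_forall in hf. apply hf, in_map. now apply nth_error_In in h.
Qed.

(* Register allocation of the reduction: 0 holds [N], 1 the digit base [q],
   2 a loop flag, 3 the round counter, 4 the base address of the current
   round, 5 the cell counter, 6 the answer of the simulated program, 7 the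
   answer so far, 8 is scratch.  Register [r] of the simulated program is
   register [9 + r], and its memory cell [a] is the cell [a] after the base
   address. *)
Definition sim_instr (o exit : nat) (ins : instr) : list instr :=
  match ins with
  | Const r v => [Const (9 + r) v; Const 8 0; Const 8 0]
  | Op b r x y => [Op b (9 + r) (9 + x) (9 + y); Const 8 0; Const 8 0]
  | Read r a => [Op Add 8 4 (9 + a); Read (9 + r) 8; Const 8 0]
  | Write a r => [Op Add 8 4 (9 + a); Write 8 (9 + r); Const 8 0]
  | JumpZ r l => [JumpZ (9 + r) (o + 3 * l); Const 8 0; Const 8 0]
  | Halt b => [Const 6 (Nat.b2n b); Const 8 0; JumpZ 8 exit]
  end.

Definition sim (P : program) (o : nat) : list instr :=
  flat_map (sim_instr o (o + 3 * length P)) P.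

(** Used with [n = 3]: the padding to three instructions turns the simulated address [l] into
    [o + 3 * l]. *)
Lemma nth_error_flat_map_const (T U : Type) (f : T -> list U) n l : (forall x, length (f x) = n) ->
  forall i x j, nth_error l i = Some x -> j < n ->
  nth_error (flat_map f l) (n * i + j) = nth_error (f x) j.
Proof.
  intros hf; induction l as [|y l IH]; intros [|i] x j hx hj; try discriminate hx; simpl.
  - injection hx as ->. rewrite Nat.mul_0_r. apply nth_error_app1. now rewrite hf.
  - rewrite nth_error_app2 by (rewrite hf; nia). rewrite hf.
    replace (n * S i + j - n) with (n * i + j) by nia. now apply IH.
Qed.

Lemma sim_instr_length o exit ins : length (sim_instr o exit ins) = 3.
Proof. now destruct ins. Qed.

Lemma sim_length P o : length (sim P o) = 3 * length P.
Proof.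
  unfold sim. generalize (o + 3 * length P) as e; intros e.
  induction P as [|i P IH]; simpl; [lia|]. rewrite length_app, IH, sim_instr_length. lia.
Qed.

Lemma run_halted P b c : answers P c b -> forall t, run P t c = c.
Proof.
  intros h; induction t as [|t IH]; [reflexivity|].
  change (run P (S t) c) with (step P (run P t c)).
  rewrite IH. unfold step. now rewrite h.
Qed.

Lemma run_stuck P c : nth_error P (pc c) = None -> forall t, run P t c = c.
Proof.
  intros h; induction t as [|t IH]; [reflexivity|].
  change (run P (S t) c) with (step P (run P t c)).
  rewrite IH. unfold step. now rewrite h.
Qed.

Lemma run_S P t c : run P (S t) c = run P t (step P c).
Proof. apply (run_add P 1 t c). Qed.

Section Machine.

Context (Q : program) (B X d : nat) (hXB : X <= B).

Definition ok (c : config) : Prop := below B c /\ bounded X d (reg c) (mem c).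

Lemma ok_reg c p r v : ok c -> v < X -> ok (Config p (update (reg c) r v) (mem c)).
Proof using hXB.
  intros [h1 [h2 h3]] hv. split; [apply below_reg; trivial; lia|]. split; simpl; trivial.
  intros y hy. apply update_lt; auto.
Qed.

Lemma ok_mem c p a v : ok c -> v < X -> ok (Config p (reg c) (update (mem c) a v)).
Proof using hXB.
  intros [h1 [h2 h3]] hv. split; [apply below_mem; trivial; lia|]. split; simpl; trivial.
  intros y. apply update_lt; auto.
Qed.

Lemma reach_const T c r v Post : ok c -> nth_error Q (pc c) = Some (Const r v) -> v < X ->
  (let c' := Config (S (pc c)) (update (reg c) r v) (mem c) in ok c' -> reach Q B T c' Post) ->
  reach Q B (S T) c Post.
Proof using hXB.
  intros hok hi hv h. apply reach_step; [apply hok|]. unfold step. rewrite hi.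
  apply h. now apply ok_reg.
Qed.

Lemma reach_op T c o r x y Post : ok c -> nth_error Q (pc c) = Some (Op o r x y) ->
  eval_binop o (reg c x) (reg c y) < X ->
  (let c' := Config (S (pc c)) (update (reg c) r (eval_binop o (reg c x) (reg c y))) (mem c) in
   ok c' -> reach Q B T c' Post) ->
  reach Q B (S T) c Post.
Proof using hXB.
  intros hok hi hv h. apply reach_step; [apply hok|]. unfold step. rewrite hi.
  apply h. now apply ok_reg.
Qed.

Lemma reach_read T c r a Post : ok c -> nth_error Q (pc c) = Some (Read r a) ->
  (let c' := Config (S (pc c)) (update (reg c) r (mem c (reg c a))) (mem c) in
   ok c' -> reach Q B T c' Post) ->
  reach Q B (S T) c Post.
Proof using hXB.
  intros hok hi h. apply reach_step; [apply hok|]. unfold step. rewrite hi.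
  apply h. apply ok_reg; trivial. apply hok.
Qed.

Lemma reach_write T c a r Post : ok c -> nth_error Q (pc c) = Some (Write a r) -> r < d ->
  (let c' := Config (S (pc c)) (reg c) (update (mem c) (reg c a) (reg c r)) in
   ok c' -> reach Q B T c' Post) ->
  reach Q B (S T) c Post.
Proof using hXB.
  intros hok hi hr h. apply reach_step; [apply hok|]. unfold step. rewrite hi.
  apply h. apply ok_mem; trivial. now apply hok.
Qed.

Lemma reach_jumpz T c r l Post : ok c -> nth_error Q (pc c) = Some (JumpZ r l) ->
  (let c' := Config (if reg c r =? 0 then l else S (pc c)) (reg c) (mem c) in
   ok c' -> reach Q B T c' Post) ->
  reach Q B (S T) c Post.
Proof using.
  intros hok hi h. apply reach_step; [apply hok|]. unfold step. rewrite hi.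
  apply h. exact hok.
Qed.

End Machine.

(** * Step-by-step simulation inside a memory segment *)

Section Simulation.

Context (P Q : program) (o base Z w B X : nat).

Let m := num_regs P.

Context (hXB : X <= B) (hX : 2 <= X) (hw : 2 ^ w <= Z) (hZ : base + Z <= X)
  (hcode : code_at Q o (sim P o)).

(** Comparing memory below [Z] suffices: a run that fits in [w] bits uses only addresses below
    [2 ^ w <= Z]. *)
Definition simulates (c cP : config) : Prop :=
  pc c = o + 3 * pc cP /\ reg c 4 = base /\
  (forall r, r < m -> reg c (9 + r) = reg cP r) /\
  (forall a, a < Z -> mem c (base + a) = mem cP a).

(** Only memory below [base] is protected: the rounds move downwards, so later ones work entirely
    there. *)
Definition frame (c c' : config) : Prop :=
  (forall y, y < 9 -> y <> 6 -> y <> 8 -> reg c' y = reg c y) /\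
  (forall a, a < base -> mem c' a = mem c a).

Lemma sim_code i ins j : nth_error P i = Some ins -> j < 3 ->
  nth_error Q (o + 3 * i + j) = nth_error (sim_instr o (o + 3 * length P) ins) j.
Proof using hcode.
  intros hi hj.
  destruct (nth_error (sim_instr o (o + 3 * length P) ins) j) as [x|] eqn:e.
  - rewrite <- Nat.add_assoc. apply hcode. unfold sim.
    rewrite <- e. apply nth_error_flat_map_const; trivial. apply sim_instr_length.
  - apply nth_error_None in e. rewrite sim_instr_length in e. now apply Nat.le_ngt in e.
Qed.

Lemma sim_step c cP ins : nth_error P (pc cP) = Some ins -> (forall b, ins <> Halt b) ->
  ok B X (9 + m) c -> fits w cP -> fits w (step P cP) -> simulates c cP ->
  reach Q B 3 c (fun c' => ok B X (9 + m) c' /\ simulates c' (step P cP) /\ frame c c').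
Proof using hXB hX hw hZ hcode.
  intros hi hnh hok [f1 f2] hf' (e1 & e2 & e3 & e4).
  pose proof (instr_regs_le _ _ _ hi) as hr; fold m in hr.
  pose proof (sim_code _ _ 0 hi ltac:(lia)) as h0.
  pose proof (sim_code _ _ 1 hi ltac:(lia)) as h1.
  pose proof (sim_code _ _ 2 hi ltac:(lia)) as h2.
  rewrite Nat.add_0_r in h0.
  replace (o + 3 * pc cP + 1) with (S (pc c)) in h1 by lia.
  replace (o + 3 * pc cP + 2) with (S (S (pc c))) in h2 by lia.
  rewrite <- e1 in h0.
  assert (z0 : 0 < X) by lia.
  assert (hlt : forall r, reg cP r < Z) by (intros r; specialize (f1 r); lia).
  destruct hf' as [g1 g2].
  unfold step in *; rewrite hi in *.
  destruct ins as [r v|b r x y|r a|a r|r l|b]; cbn [sim_instr nth_error instr_regs] in *;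
    cbn [pc reg mem] in *.
  (* The value written is bounded because the successor configuration of the simulated program
     fits. *)
  - specialize (g1 r); rewrite update_eq in g1.
    eapply reach_const; [exact hXB|exact hok|exact h0|lia|]; intros c1 ok1.
    eapply reach_const; [exact hXB|exact ok1|exact h1|lia|]; intros c2 ok2.
    eapply reach_const; [exact hXB|exact ok2|exact h2|lia|]; intros c3 ok3.
    apply reach_here; [apply ok3|]. split; [exact ok3|]. subst c1 c2 c3.
    split; [split; [simpl; lia|split; [simpl; exact e2|split]]|split]; simpl; trivial.
    + intros s hs. rewrite !update_neq by lia. unfold update; simpl.
      destruct (s =? r) eqn:e; trivial. now apply e3.
    + intros y h6 h7 h8. now rewrite !update_neq by lia.
  - specialize (g1 r); rewrite update_eq in g1.
    rewrite <- (e3 x), <- (e3 y) in * by lia.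
    eapply reach_op; [exact hXB|exact hok|exact h0|lia|]; intros c1 ok1.
    eapply reach_const; [exact hXB|exact ok1|exact h1|lia|]; intros c2 ok2.
    eapply reach_const; [exact hXB|exact ok2|exact h2|lia|]; intros c3 ok3.
    apply reach_here; [apply ok3|]. split; [exact ok3|]. subst c1 c2 c3.
    split; [split; [simpl; lia|split; [simpl; exact e2|split]]|split]; simpl; trivial.
    + intros s hs. rewrite !update_neq by lia. unfold update; simpl.
      destruct (s =? r) eqn:e; trivial. now apply e3.
    + intros z h6 h7 h8. now rewrite !update_neq by lia.
  - pose proof (hlt a) as ha.
    eapply reach_op; [exact hXB|exact hok|exact h0|rewrite e2, e3 by lia; simpl; lia|]; intros c1 ok1.
    eapply reach_read; [exact hXB|exact ok1|exact h1|]; intros c2 ok2.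
    eapply reach_const; [exact hXB|exact ok2|exact h2|lia|]; intros c3 ok3.
    apply reach_here; [apply ok3|]. split; [exact ok3|]. subst c1 c2 c3.
    split; [split; [simpl; lia|split; [simpl; exact e2|split]]|split]; simpl; trivial.
    + intros s hs. rewrite !update_neq by lia. rewrite update_eq.
      change (S (S (S (S (S (S (S (S (S a))))))))) with (9 + a).
      rewrite e2, e3, e4 by lia. unfold update; simpl.
      destruct (s =? r) eqn:e; trivial. now apply e3.
    + intros z h6 h7 h8. now rewrite !update_neq by lia.
  - pose proof (hlt a) as ha.
    eapply reach_op; [exact hXB|exact hok|exact h0|rewrite e2, e3 by lia; simpl; lia|]; intros c1 ok1.
    eapply reach_write; [exact hXB|exact ok1|exact h1|lia|]; intros c2 ok2.
    eapply reach_const; [exact hXB|exact ok2|exact h2|lia|]; intros c3 ok3.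
    apply reach_here; [apply ok3|]. split; [exact ok3|]. subst c1 c2 c3.
    cbn [pc reg mem]. rewrite update_eq. rewrite !(update_neq _ _ _ (9 + r)) by lia.
    rewrite e2, !e3 by lia. cbn [eval_binop].
    split; [split; [simpl; lia|split; [simpl; exact e2|split]]|split]; simpl; trivial.
    + intros s hs. unfold update at 1 2. rewrite e4 by trivial.
      destruct (s =? reg cP a) eqn:e.
      * apply Nat.eqb_eq in e; subst s. now rewrite Nat.eqb_refl.
      * apply Nat.eqb_neq in e. now rewrite (proj2 (Nat.eqb_neq _ _)) by lia.
    + intros z h6 h7 h8. now rewrite !update_neq by lia.
    + intros z h6. now rewrite update_neq by lia.
  - eapply reach_jumpz; [exact hok|exact h0|]; intros c1 ok1.
    pose proof (e3 r ltac:(lia)) as e5. subst c1. rewrite e5 in *. destruct (reg cP r =? 0).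
    + apply reach_here; [apply ok1|]. split; [exact ok1|]. 
      split; [repeat split; simpl; trivial|split; trivial].
    + eapply reach_const; [exact hXB|exact ok1|exact h1|lia|]; intros c2 ok2.
      eapply reach_const; [exact hXB|exact ok2|exact h2|lia|]; intros c3 ok3.
      apply reach_here; [apply ok3|]. split; [exact ok3|]. subst c2 c3.
      split; [split; [simpl; lia|split; [simpl; exact e2|split]]|split]; simpl; trivial.
      * intros z h6 h7 h8. now rewrite !update_neq by lia.
  - now destruct (hnh b).
Qed.

(** Three machine steps per simulated step, and three more to record the answer and jump to the
    exit. *)
Lemma sim_run b T : forall c cP, ok B X (9 + m) c -> simulates c cP ->
  (forall t, fits w (run P t cP)) -> answers P (run P T cP) b ->
  reach Q B (3 * T + 3) c (fun c' => pc c' = o + 3 * length P /\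
    bounded X (9 + m) (reg c') (mem c') /\ reg c' 6 = Nat.b2n b /\ frame c c').
Proof using hXB hX hw hZ hcode.
  assert (halted : forall T c cP, ok B X (9 + m) c -> simulates c cP -> answers P cP b ->
    reach Q B (T + 3) c (fun c' => pc c' = o + 3 * length P /\
      bounded X (9 + m) (reg c') (mem c') /\ reg c' 6 = Nat.b2n b /\ frame c c')).
  { intros T' c cP hok (e1 & e2 & e3 & e4) ha.
    pose proof (sim_code _ _ 0 ha ltac:(lia)) as h0.
    pose proof (sim_code _ _ 1 ha ltac:(lia)) as h1.
    pose proof (sim_code _ _ 2 ha ltac:(lia)) as h2.
    rewrite Nat.add_0_r in h0.
    replace (o + 3 * pc cP + 1) with (S (pc c)) in h1 by lia.
    replace (o + 3 * pc cP + 2) with (S (S (pc c))) in h2 by lia.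
    rewrite <- e1 in h0. pose proof (b2n_le b). rewrite (Nat.add_comm T').
    eapply reach_const; [exact hXB|exact hok|exact h0|lia|]; intros c1 ok1.
    eapply reach_const; [exact hXB|exact ok1|exact h1|lia|]; intros c2 ok2.
    eapply reach_jumpz; [exact ok2|exact h2|]; intros c3 ok3.
    apply reach_here; [apply ok3|]. split; [reflexivity|]. split; [apply ok3|].
    split; [reflexivity|]. split; [|reflexivity].
    intros y h6 h7 h8. subst c1 c2 c3. simpl. now rewrite !update_neq by lia. }
  induction T as [|T IH]; intros c cP hok hs hf ha.
  - now apply (halted 0 c cP).
  - destruct (nth_error P (pc cP)) as [ins|] eqn:hi.
    + destruct (match ins with Halt b' => Some b' | _ => None end) as [b'|] eqn:hh.
      * assert (ins = Halt b') as -> by (destruct ins; congruence).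
        rewrite (run_halted P b' cP hi) in ha. now apply (halted (3 * S T) c cP).
      * assert (hnh : forall b', ins <> Halt b') by (intros b' ->; discriminate).
        rewrite run_S in ha.
        eapply reach_bind; [apply (sim_step c cP ins hi hnh hok (hf 0) (hf 1) hs)| |].
        { instantiate (1 := 3 * T + 3). lia. }
        intros c1 _ (ok1 & s1 & fr1).
        eapply reach_mono; [apply (IH c1 _ ok1 s1); trivial|apply le_n|].
        -- intros t. rewrite <- run_S. apply hf.
        -- intros c2 _ (g1 & g2 & g3 & g4). repeat split; trivial; try apply g2.
           ++ intros. rewrite (proj1 g4), (proj1 fr1); trivial.
           ++ intros. rewrite (proj2 g4), (proj2 fr1); trivial.
    (* A run that has left the program is stuck without an answer, contrary to [ha]. *)
    + rewrite (run_stuck P cP hi) in ha. unfold answers in ha. congruence.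
Qed.

End Simulation.

(** [F] stands for the caller's invariant; it survives because it depends only on memory below
    [base] and on registers below 9 other than 6 and 8. *)
Lemma hoare_sim P X sz base Z w N A b T (F : assertion) :
  2 <= X -> 1 <= sz -> 2 ^ w <= Z -> base + Z <= X ->
  (forall t, fits w (run P t (input N A))) -> answers P (run P T (input N A)) b ->
  (forall R R' M M', F R M -> (forall y, y < 9 -> y <> 6 -> y <> 8 -> R' y = R y) ->
    (forall a, a < base -> M' a = M a) -> F R' M') ->
  hoare X (9 + num_regs P) sz (Raw (sim P)) (3 * T + 3)
    (fun R M => F R M /\ R 4 = base /\
      (forall r, r < num_regs P -> R (9 + r) = update (fun _ => 0) 0 N r) /\
      (forall a, a < Z -> M (base + a) = Nat.b2n (A a)))
    (fun R M => F R M /\ R 6 = Nat.b2n b).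
Proof.
  intros hX hsz hw hZ hf ha hF _ _ Q c hc hb hbd (p1 & p2 & p3 & p4).
  cbn [gen] in *. rewrite sim_length.
  eapply reach_mono; [apply (sim_run P Q (pc c) base Z w (X ^ sz) X)
    with (cP := input N A) (b := b) (T := T)|apply le_n|]; trivial.
  - rewrite <- (Nat.pow_1_r X) at 1. apply Nat.pow_le_mono_r; lia.
  - now split.
  - split; [simpl; lia|]. now split.
  - intros c' _ (e1 & e2 & e3 & e4 & e5). repeat split; trivial; try apply e2.
    eapply hF; eauto.
Qed.

(** * The reduction as a program *)

Fixpoint e_pow (e : expr) (n : nat) : expr :=
  match n with
  | 0 => Cst 1
  | S n' => Bin Mul e (e_pow e n')
  end.

Fixpoint e_square_sum (t : nat) (e : expr) : expr :=
  match t with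
  | 0 => Cst 0
  | S t' => Bin Add (Bin Mul (Bin Mod e (Var 1)) (Bin Mod e (Var 1)))
              (e_square_sum t' (Bin Div e (Bin Mul (Cst 2) (Var 1))))
  end.

Fixpoint e_high_bits (t : nat) (e : expr) : expr :=
  match t with
  | 0 => Cst 0
  | S t' => Bin Add (Bin Mod (Bin Div e (Var 1)) (Cst 2))
              (Bin Mul (Cst 2) (e_high_bits t' (Bin Div e (Bin Mul (Cst 2) (Var 1)))))
  end.

Definition e_tqq (t : nat) : expr := Bin Mul (Bin Mul (Cst t) (Var 1)) (Var 1).

Definition e_color (t : nat) (e : expr) : expr :=
  Bin Add (e_square_sum t e) (Bin Mul (e_tqq t) (e_high_bits t e)).

Definition e_block : expr := Bin Add (Bin Mul (Cst 4) (Var 0)) (Cst 1).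

Definition e_top (k : nat) : expr :=
  Bin Add (Bin Mul (Cst k) e_block) (Bin Mul (Cst 2) (Var 0)).

(** The segment length: a fixed power, computable by multiplications, and at least the number of
    addresses available to the simulated program. *)
Definition e_stride (k c : nat) : expr := e_pow (Bin Mul (Cst 2) (e_top k)) c.

Definition e_colors (t : nat) : expr := Bin Mul (e_tqq t) (Cst (2 ^ t)).

Definition e_rounds (t : nat) : expr :=
  Bin Mul (e_colors t) (Bin Mul (Bin Mul (Cst 2) (Var 1)) (Cst t)).

(** Products are conjunctions and the positive inner sum is a disjunction. The outer sum stays at
    most 1 because [i < k] and [i = k] exclude each other. [Rd o] reads [A] from segment 0. *)
Definition e_cell (k t : nat) : expr :=
  let i := Bin Div (Var 5) e_block in
  let o := Bin Mod (Var 5) e_block in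
  let l := Bin Div (Var 3) (e_colors t) in
  let c := Bin Mod (Var 3) (e_colors t) in
  Bin Add
    (Bin Mul (Bin Mul (Bin Ltb i (Cst k)) (Rd o))
       (Bin Ltb (Cst 0)
          (Bin Add (Bin Ltb (Cst 1) i) (Bin Eqb i (Bin Mod (Bin Shr o l) (Cst 2))))))
    (Bin Mul (Bin Eqb i (Cst k)) (Bin Eqb (e_color t o) c)).

Definition e_small (t : nat) : expr :=
  Bin Ltb (e_pow (Bin Mul (Cst 2) (Var 1)) t) (Bin Add (Bin Mul (Cst 2) (Var 0)) (Cst 1)).

Definition next_base (t : nat) : stmt :=
  Seq (Asg 1 (Bin Add (Var 1) (Cst 1))) (Asg 2 (e_small t)).

(** A linear search is affordable, the result being of order [N ^ (1 / t)]. *)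
Definition find_base (t : nat) : stmt :=
  Seq (Seq (Asg 1 (Cst 1)) (Asg 2 (e_small t))) (Whl 2 (next_base t)).

Definition write_cell (k t : nat) : stmt :=
  Seq (Asg 5 (Bin Sub (Var 5) (Cst 1))) (Sto (Bin Add (Var 4) (Var 5)) (e_cell k t)).

(** Unlike memory, the simulated registers are shared by all rounds and must be cleared. *)
Fixpoint zero_registers (n : nat) : stmt :=
  match n with
  | 0 => Raw (fun _ => [])
  | S n' => Seq (zero_registers n') (Asg (9 + n') (Cst 0))
  end.

(** Round [n] works at [(n + 1) * Z]. As [n] decreases, its segment lies below all those already
    written, and segment 0 keeps the input. *)
Definition start_round (k c : nat) : stmt :=
  Seq (Seq (Asg 3 (Bin Sub (Var 3) (Cst 1)))
    (Asg 4 (Bin Mul (Bin Add (Var 3) (Cst 1)) (e_stride k c))))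
    (Asg 5 (Bin Add (e_top k) (Cst 1))).

Definition load (P : program) (k : nat) : stmt :=
  Seq (zero_registers (num_regs P)) (Asg 9 (e_top k)).

Definition collect : stmt := Asg 7 (Bin Ltb (Cst 0) (Bin Add (Var 7) (Var 6))).

Definition round (P : program) (k t c : nat) : stmt :=
  Seq (start_round k c) (Seq (Whl 5 (write_cell k t))
    (Seq (load P k) (Seq (Raw (sim P)) collect))).

Definition reduction (P : program) (k t c : nat) : stmt :=
  Seq (Seq (find_base t) (Asg 3 (e_rounds t))) (Whl 3 (round P k t c)).

(** * Values and well-formedness of the expressions *)

Lemma ev_pow e n R M : ev (e_pow e n) R M = ev e R M ^ n.
Proof. induction n as [|n IH]; cbn [e_pow ev eval_binop Nat.pow]; congruence. Qed.

Lemma ev_square_sum t R M : forall e,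
  ev (e_square_sum t e) R M = square_sum (R 1) t (ev e R M).
Proof.
  induction t as [|t IH]; intros e; cbn [e_square_sum square_sum ev eval_binop]; trivial.
  rewrite IH. reflexivity.
Qed.

Lemma ev_high_bits t R M : forall e,
  ev (e_high_bits t e) R M = high_bits (R 1) t (ev e R M).
Proof.
  induction t as [|t IH]; intros e; cbn [e_high_bits high_bits ev eval_binop]; trivial.
  rewrite IH. reflexivity.
Qed.

Lemma ev_color t R M e : ev (e_color t e) R M = color (R 1) t (ev e R M).
Proof.
  unfold e_color, color, e_tqq. cbn [ev eval_binop].
  now rewrite ev_square_sum, ev_high_bits.
Qed.

Lemma ev_top k R M : ev (e_top k) R M = top k (R 0).
Proof. reflexivity. Qed.

Lemma ev_stride k c R M : ev (e_stride k c) R M = (2 * top k (R 0)) ^ c.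
Proof. unfold e_stride. rewrite ev_pow. reflexivity. Qed.

Lemma ev_colors t R M : ev (e_colors t) R M = colors t (R 1).
Proof. reflexivity. Qed.

Lemma ev_rounds t R M : ev (e_rounds t) R M = rounds t (R 1).
Proof. reflexivity. Qed.

Lemma ev_small t R M : ev (e_small t) R M = Nat.b2n ((2 * R 1) ^ t <? 2 * R 0 + 1).
Proof. unfold e_small. cbn [ev eval_binop]. now rewrite ev_pow. Qed.

Lemma ev_cell k t R M A : M (R 5 mod block (R 0)) = Nat.b2n (A (R 5 mod block (R 0))) ->
  ev (e_cell k t) R M =
  Nat.b2n (cell k t (R 0) (R 1) A (R 3 / colors t (R 1)) (R 3 mod colors t (R 1)) (R 5)).
Proof.
  intros h. unfold e_cell, cell. cbv zeta. cbn [ev eval_binop].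
  rewrite ev_colors, ev_color. cbn [ev eval_binop].
  change (ev e_block R M) with (block (R 0)).
  rewrite h, Nat.shiftr_div_pow2.
  set (i := R 5 / block (R 0)); set (o := R 5 mod block (R 0)).
  destruct (i <? k) eqn:e1; destruct (i =? k) eqn:e2.
  { apply Nat.ltb_lt in e1. apply Nat.eqb_eq in e2. lia. }
  all: destruct (A o), (1 <? i), (i =? (o / 2 ^ _) mod 2), (color (R 1) t o =? _); reflexivity.
Qed.

Lemma eok_pow d e n : eok d e -> eok d (e_pow e n).
Proof. intros he. induction n as [|n IH]; simpl; auto. Qed.

Lemma eok_square_sum d t : 1 < d -> forall e, eok d e -> eok d (e_square_sum t e).
Proof.
  intros hd. induction t as [|t IH]; intros e he; simpl; repeat split; auto.
  apply IH; simpl; auto.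
Qed.

Lemma eok_high_bits d t : 1 < d -> forall e, eok d e -> eok d (e_high_bits t e).
Proof.
  intros hd. induction t as [|t IH]; intros e he; simpl; repeat split; auto.
  apply IH; simpl; auto.
Qed.

Lemma sok_zero_registers d n : 9 + n <= d -> sok d (zero_registers n).
Proof.
  induction n as [|n IH]; intros hn; [exact I|].
  split; [apply IH; lia|]. split; [lia|exact I].
Qed.

Lemma sok_reduction P k t c : sok (9 + num_regs P) (reduction P k t c).
Proof.
  unfold reduction, round, load, find_base, next_base, start_round, collect, write_cell.
  assert (hd : 9 < 9 + num_regs P) by (unfold num_regs; lia).
  generalize dependent (num_regs P); intros m hd. pose proof (sok_zero_registers (9 + m) m (le_n _)).
  cbn [sok]. repeat split; trivial; try lia;
    try (first [apply eok_square_sum | apply eok_high_bits | apply eok_pow];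
      simpl; repeat split; lia); try (simpl; lia).
Qed.

(** Loops and raw code count 0; their time is added explicitly in the triples. *)
Fixpoint cost (d : nat) (s : stmt) : nat :=
  match s with
  | Asg x e => length (comp e d) + 1
  | Sto a v => length (comp a d) + (length (comp v (S d)) + 1)
  | Seq s1 s2 => cost d s1 + cost d s2
  | Whl _ _ | Raw _ => 0
  end.

(** * Correctness and cost of the reduction *)

Section Correctness.

Context (P : program) (k t c N q T w : nat) (A : nat -> bool) (X sz : nat).

Let d := 9 + num_regs P.
Let Z := (2 * top k N) ^ c.
Let J := rounds t q.
Let H j := has_kAP (S k) (round_instance k t N q A j).

Context (hk : 2 <= k) (hX : 2 <= X) (hsz : 1 <= sz)
  (hq1 : 1 <= q) (hqN : 2 * N < (2 * q) ^ t)
  (hqmin : forall q', 1 <= q' < q -> (2 * q') ^ t <= 2 * N)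
  (hqX : q < X) (hJX : J < X) (htopX : top k N + 1 < X) (hZX : (J + 1) * Z <= X)
  (hA : subset_upto N A) (hwZ : 2 ^ w <= Z) (htopw : top k N < 2 ^ w)
  (hP : forall j, j < J ->
    (forall s, fits w (run P s (input (top k N) (round_instance k t N q A j)))) /\
    exists b, answers P (run P T (input (top k N) (round_instance k t N q A j))) b /\
      (b = true <-> H j)).

Lemma N_le_top : N <= top k N.
Proof. unfold top. lia. Qed.

(** [n] is the number of increments still missing to reach the digit base. *)
Definition searched (n : nat) : assertion := fun R M =>
  R 0 = N /\ R 1 + n = q /\ 1 <= R 1 /\ R 2 = Nat.b2n ((2 * R 1) ^ t <? 2 * N + 1) /\
  R 7 = 0 /\ (forall a, M a = Nat.b2n (A a)).

Definition initial : assertion := fun R M =>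
  R 0 = N /\ R 7 = 0 /\ (forall a, M a = Nat.b2n (A a)).

Lemma b2n_zero b : Nat.b2n b = 0 <-> b = false.
Proof. destruct b; simpl; split; congruence. Qed.

Lemma searched_done n R M : searched n R M -> (R 2 = 0 <-> n = 0).
Proof.
  intros (e0 & e1 & h1 & e2 & _). rewrite e2, b2n_zero, Nat.ltb_ge. split.
  - intros h. destruct n as [|n]; trivial.
    specialize (hqmin (R 1) ltac:(lia)). lia.
  - intros ->. rewrite Nat.add_0_r in e1. rewrite e1. lia.
Qed.

Lemma searched_ext n R R' M : (forall y, y < d -> R' y = R y) ->
  searched n R M -> searched n R' M.
Proof. unfold searched, d. intros h. now rewrite !h by lia. Qed.

Lemma next_base_correct n :
  hoare X d sz (next_base t) (cost d (next_base t)) (searched (S n)) (searched n).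
Proof.
  unfold next_base; cbn [cost].
  apply hoare_seq with (Mid := fun R M => R 0 = N /\ R 1 + n = q /\ 1 <= R 1 /\
    R 7 = 0 /\ (forall a, M a = Nat.b2n (A a))); trivial; apply hoare_asg; trivial.
  - intros R M _ (e0 & e1 & h1 & e2 & e7 & hM). cbn [ev eval_binop]. split; [lia|].
    intros R' h h'. repeat split; trivial; try (rewrite h' by (unfold d; lia)); lia.
  - intros R M _ (e0 & e1 & h1 & e7 & hM). rewrite ev_small. rewrite e0.
    split; [pose proof (b2n_le ((2 * R 1) ^ t <? 2 * N + 1)); lia|].
    intros R' h h'. unfold searched. rewrite h, !h' by (unfold d; lia). repeat split; trivial.
Qed.

Lemma find_base_correct : hoare X d sz (find_base t)
  (cost d (find_base t) + (q * (cost d (next_base t) + 3) + 1)) initial (searched 0).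
Proof.
  unfold find_base; cbn [cost]. rewrite Nat.add_0_r.
  apply hoare_seq with (Mid := searched (q - 1)); trivial.
  - apply hoare_seq with (Mid := fun R M => R 0 = N /\ R 1 = 1 /\
      R 7 = 0 /\ (forall a, M a = Nat.b2n (A a))); trivial; apply hoare_asg; trivial.
    + intros R M _ (e0 & e7 & hM). cbn [ev]. split; [lia|].
      intros R' h h'. repeat split; trivial; rewrite h' by (unfold d; lia); trivial.
    + intros R M _ (e0 & e1 & e7 & hM). rewrite ev_small. rewrite e0.
      split; [pose proof (b2n_le ((2 * R 1) ^ t <? 2 * N + 1)); lia|].
      intros R' h h'. unfold searched. rewrite h, !h' by (unfold d; lia).
      repeat split; trivial; lia.
  - eapply hoare_conseq; [apply hoare_whl with (Inv := searched) (n := q - 1);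
      [exact hX|exact searched_done|
      exact next_base_correct|intros; eapply searched_ext; eauto]| |auto|auto].
    apply Nat.add_le_mono_r, Nat.mul_le_mono_r. lia.
Qed.

Definition found (n v : nat) : Prop :=
  v <= 1 /\ (v <> 0 <-> exists j, n <= j /\ j < J /\ H j).

(** The state once the rounds [J - 1] down to [n] are done; memory below the segment of round [n] is
    still the input. *)
Definition pending (n : nat) : assertion := fun R M =>
  n <= J /\ R 0 = N /\ R 1 = q /\ R 3 = n /\ found n (R 7) /\
  (forall a, a < (n + 1) * Z -> M a = Nat.b2n (A a)).

Definition core (n : nat) : assertion := fun R M =>
  n < J /\ R 0 = N /\ R 1 = q /\ R 3 = n /\ found (S n) (R 7) /\
  (forall a, a < (n + 1) * Z -> M a = Nat.b2n (A a)).

Lemma core_ext n R R' M M' : core n R M ->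
  R' 0 = R 0 -> R' 1 = R 1 -> R' 3 = R 3 -> R' 7 = R 7 ->
  (forall a, a < (n + 1) * Z -> M' a = M a) -> core n R' M'.
Proof.
  unfold core. intros (h & h0 & h1 & h3 & h7 & hM) -> -> -> -> e.
  repeat split; trivial; try apply h7. intros a ha. rewrite e; auto.
Qed.

(** The cells from [p] to the end of the segment are already correct, as filling proceeds
    downwards. *)
Definition filling (n p : nat) : assertion := fun R M =>
  core n R M /\ R 4 = (n + 1) * Z /\ R 5 = p /\ p <= top k N + 1 /\
  (forall a, a < Z -> p <= a ->
    M ((n + 1) * Z + a) = Nat.b2n (round_instance k t N q A n a)).

Lemma base_lt n : n < J -> (n + 1) * Z + Z <= X.
Proof.
  intros hn. pose proof (Nat.mul_le_mono_r (n + 2) (J + 1) Z ltac:(lia)). lia.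
Qed.

Lemma Z_pos : 1 <= Z.
Proof. lia. Qed.

Lemma start_round_correct n : hoare X d sz (start_round k c) (cost d (start_round k c))
  (pending (S n)) (filling n (top k N + 1)).
Proof.
  unfold start_round; cbn [cost]. pose proof Z_pos as hZ1.
  set (mem_ok := fun M : nat -> nat =>
    forall a, a < (S n + 1) * Z -> M a = Nat.b2n (A a)).
  assert (hlt : forall a, a < (n + 1) * Z -> a < (S n + 1) * Z) by lia.
  apply hoare_seq with (Mid := fun R M => core n R M /\ mem_ok M /\ R 4 = (n + 1) * Z);
    [trivial|apply hoare_seq with (Mid := fun R M => core n R M /\ mem_ok M); [trivial| |]|];
    apply hoare_asg; trivial; intros R M _.
  - intros (hn & h0 & h1 & h3 & h7 & hM). cbn [ev eval_binop]. split; [lia|].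
    intros R' h h'. split; [|exact hM].
    unfold core. rewrite h, !h' by (unfold d; lia). repeat split; trivial; try apply h7; try lia.
    intros a ha. apply hM. auto.
  - intros [hc hM]. pose proof hc as (hn & h0 & h1 & h3 & h7 & hM').
    cbn [ev eval_binop]. rewrite ev_stride, h0, h3. fold Z. pose proof (base_lt n hn).
    split; [lia|]. intros R' h h'. split; [|split; trivial].
    apply (core_ext n R R' M M hc); trivial; apply h'; unfold d; lia.
  - intros (hc & hM & h4). pose proof hc as (hn & h0 & h1 & h3 & h7 & hM').
    cbn [ev eval_binop]. rewrite ev_top, h0.
    split; [lia|]. intros R' h h'. split; [|split; [rewrite h' by (unfold d; lia); exact h4|]].
    + apply (core_ext n R R' M M hc); trivial; apply h'; unfold d; lia.
    + split; [exact h|]. split; [lia|]. intros a ha1 ha2. rewrite hM by lia. f_equal.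
      (* Both sides vanish: the address lies in a fresh segment beyond [N], and [a] exceeds
         [top k N]. *)
      transitivity false.
      * destruct (A _) eqn:e; trivial. apply hA in e. pose proof N_le_top. lia.
      * unfold round_instance, instance. symmetry. apply andb_false_iff. left.
        apply Nat.leb_gt. lia.
Qed.

Lemma write_cell_correct n p : hoare X d sz (write_cell k t) (cost d (write_cell k t))
  (filling n (S p)) (filling n p).
Proof.
  unfold write_cell; cbn [cost].
  apply hoare_seq with (Mid := fun R M => core n R M /\ R 4 = (n + 1) * Z /\ R 5 = p /\
    S p <= top k N + 1 /\ (forall a, a < Z -> S p <= a ->
    M ((n + 1) * Z + a) = Nat.b2n (round_instance k t N q A n a))); trivial.
  - apply hoare_asg; trivial. intros R M _ (hc & h4 & h5 & hp & hM).
    cbn [ev eval_binop]. split; [lia|]. intros R' h h'.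
    split; [apply (core_ext n R R' M M hc); trivial; apply h'; unfold d; lia|].
    rewrite h, h' by (unfold d; lia). repeat split; trivial; lia.
  - apply hoare_sto; trivial. intros R M _ (hc & h4 & h5 & hp & hM).
    pose proof hc as (hn & h0 & h1 & h3 & h7 & hM').
    assert (hcell : ev (e_cell k t) R M = Nat.b2n (round_instance k t N q A n p)).
    { rewrite (ev_cell k t R M A).
      - rewrite h0, h1, h3, h5. unfold round_instance, instance.
        now rewrite (proj2 (Nat.leb_le p (top k N))) by lia.
      (* The address read is at most [p], hence below [Z], where [A] is intact. *)
      - apply hM'. pose proof (Nat.Div0.mod_le (R 5) (block (R 0))). lia. }
    rewrite hcell. cbn [ev eval_binop]. rewrite h4, h5.
    split; [pose proof (b2n_le (round_instance k t N q A n p)); lia|].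
    intros R' h'. split; [|rewrite !h' by (unfold d; lia); repeat split; trivial; try lia].
    + apply (core_ext n R R' M _ hc); try (apply h'; unfold d; lia).
      intros a ha. apply update_neq. lia.
    + intros a ha1 ha2. destruct (Nat.eq_dec a p) as [->|ne]; [apply update_eq|].
      rewrite update_neq by lia. apply hM; lia.
Qed.

Definition loaded (n r : nat) : assertion := fun R M =>
  core n R M /\ R 4 = (n + 1) * Z /\
  (forall a, a < Z -> M ((n + 1) * Z + a) = Nat.b2n (round_instance k t N q A n a)) /\
  forall s, s < r -> R (9 + s) = 0.

Lemma zero_registers_correct n r : r <= num_regs P ->
  hoare X d sz (zero_registers r) (cost d (zero_registers r)) (filling n 0) (loaded n r).
Proof.
  induction r as [|r IH]; intros hr; cbn [zero_registers cost].
  - intros _ _ Q cf hc hb hbd (p1 & p2 & _ & _ & p3). apply reach_here; trivial. cbn [gen length].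
    split; [lia|]. split; trivial. split; trivial. split; trivial.
    split; [intros; apply p3; lia|lia].
  - apply hoare_seq with (Mid := loaded n r); [trivial|apply IH; lia|].
    apply hoare_asg; trivial. intros R M _ (hc & h4 & hM & hz). cbn [ev]. split; [lia|].
    intros R' h h'. split; [apply (core_ext n R R' M M hc); trivial; apply h'; unfold d; lia|].
    rewrite (h' 4) by (unfold d; lia). split; trivial. split; trivial.
    intros s hs. destruct (Nat.eq_dec s r) as [->|ne]; trivial.
    rewrite h' by (unfold d; lia). apply hz; lia.
Qed.

Lemma load_correct n : hoare X d sz (load P k) (cost d (load P k)) (filling n 0)
  (fun R M => core n R M /\ R 4 = (n + 1) * Z /\
    (forall s, s < num_regs P -> R (9 + s) = update (fun _ => 0) 0 (top k N) s) /\
    (forall a, a < Z -> M ((n + 1) * Z + a) = Nat.b2n (round_instance k t N q A n a))).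
Proof.
  unfold load; cbn [cost].
  apply hoare_seq with (Mid := loaded n (num_regs P)); [trivial|now apply zero_registers_correct|].
  apply hoare_asg; trivial. intros R M _ (hc & h4 & hM & hz).
  pose proof hc as (hn & h0 & h1 & h3 & h7 & hM').
  rewrite ev_top, h0. split; [lia|].
  intros R' h h'. split; [apply (core_ext n R R' M M hc); trivial; apply h'; unfold d; lia|].
  rewrite (h' 4) by (unfold d; lia). split; trivial. split; trivial.
  intros [|s] hs; [exact h|]. rewrite h' by (unfold d; lia). now apply hz.
Qed.

Definition round_cost : nat :=
  cost d (start_round k c) + ((top k N + 1) * (cost d (write_cell k t) + 3) + 1 +
    (cost d (load P k) + (3 * T + 3 + cost d collect))).

Lemma round_correct n : hoare X d sz (round P k t c) round_cost (pending (S n)) (pending n).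
Proof.
  (* The loop rule asks for every [n], while [hP] covers [n < J]; the precondition excludes the
     rest. *)
  destruct (le_lt_dec J n) as [hJ|hn].
  { intros _ _ Q cf _ _ _ (h & _). lia. }
  destruct (hP n hn) as (hf & b & ha & hb).
  unfold round, round_cost.
  apply hoare_seq with (Mid := filling n (top k N + 1)); [trivial|apply start_round_correct|].
  apply hoare_seq with (Mid := filling n 0); trivial.
  { apply (hoare_whl X d sz hX 5 (write_cell k t) (cost d (write_cell k t)) (filling n)).
    - intros p R M (_ & _ & -> & _). tauto.
    - intros p. apply write_cell_correct.
    - intros p R R' M h (hc & h4 & h5 & hM).
      split; [apply (core_ext n R R' M M hc); trivial; apply h; unfold d; lia|].
      rewrite !h by (unfold d; lia). now split. }
  eapply hoare_seq; [trivial|apply load_correct|].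
  eapply hoare_seq; [trivial| |].
  { eapply hoare_conseq; [eapply (hoare_sim P X sz ((n + 1) * Z) Z w (top k N)
      (round_instance k t N q A n) b T (core n)); trivial|apply le_n| |intros R M h; exact h].
    - now apply base_lt.
    - intros R R' M M' hc h h'. apply (core_ext n R R' M M' hc); trivial; apply h; lia.
    - auto. }
  unfold collect; cbn [cost].
  apply hoare_asg; trivial. intros R M _ [hc h6]. cbn [ev eval_binop].
  pose proof hc as (_ & h0 & h1 & h3 & [h7 h7'] & hM').
  rewrite h6. split; [pose proof (b2n_le (0 <? R 7 + Nat.b2n b)); lia|].
  intros R' h h'. unfold pending. rewrite h, !h' by (unfold d; lia).
  repeat split; trivial; try lia.
  - apply b2n_le.
  - intros ne. destruct (Nat.eq_dec (R 7) 0) as [e|e].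
    + exists n. repeat split; trivial. apply hb. destruct b; trivial. now rewrite e in ne.
    + apply h7' in e. destruct e as (j & j1 & j2 & j3). exists j. repeat split; trivial; lia.
  - intros (j & j1 & j2 & j3) e. apply b2n_zero, Nat.ltb_ge in e.
    destruct (Nat.eq_dec j n) as [->|ne].
    + apply hb in j3. subst b. simpl in e. lia.
    + assert (R 7 <> 0); [|lia]. apply h7'. exists j. repeat split; trivial; lia.
Qed.

Definition reduction_cost : nat :=
  cost d (find_base t) + (q * (cost d (next_base t) + 3) + 1) + cost d (Asg 3 (e_rounds t)) +
  (J * (round_cost + 3) + 1).

Lemma reduction_correct :
  hoare X d sz (reduction P k t c) reduction_cost initial (pending 0).
Proof.
  unfold reduction, reduction_cost.
  apply hoare_seq with (Mid := pending J); [trivial|apply hoare_seq with (Mid := searched 0); trivial|].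
  - apply find_base_correct.
  - apply hoare_asg; trivial. intros R M _ (h0 & h1 & _ & _ & h7 & hM).
    rewrite ev_rounds. replace (R 1) with q by lia. fold J. split; [lia|].
    intros R' h h'. unfold pending. rewrite h, !h' by (unfold d; lia).
    repeat split; trivial; try lia. intros (j & j1 & j2 & _). lia.
  - apply (hoare_whl X d sz hX 3 (round P k t c) round_cost pending).
    + intros n R M (_ & _ & _ & -> & _). tauto.
    + apply round_correct.
    + intros n R R' M h. unfold pending. now rewrite !h by (unfold d; lia).
Qed.

End Correctness.

(** * Word length and running time *)

Fixpoint least (f : nat -> bool) (fuel i : nat) : nat :=
  match fuel with
  | 0 => i
  | S n => if f i then i else least f n (S i)
  end.

Lemma least_spec f n i : f (i + n) = true ->
  i <= least f n i <= i + n /\ f (least f n i) = true /\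
  forall j, i <= j < least f n i -> f j = false.
Proof.
  revert i; induction n as [|n IH]; intros i h; simpl.
  - rewrite Nat.add_0_r in h. repeat split; trivial; lia.
  - destruct (f i) eqn:e; [repeat split; trivial; lia|].
    rewrite Nat.add_succ_r in h. destruct (IH (S i) h) as (h1 & h2 & h3).
    repeat split; trivial; try lia. intros j hj.
    destruct (Nat.eq_dec j i) as [->|ne]; trivial. apply h3. lia.
Qed.

(** For [t >= 1] the candidate [N + 1] always passes, so fuel [N] starting from 1 suffices. *)
Definition digit_base (t N : nat) : nat := least (fun q => 2 * N <? (2 * q) ^ t) N 1.

Lemma digit_base_spec t N : 1 <= t ->
  1 <= digit_base t N <= N + 1 /\ 2 * N < (2 * digit_base t N) ^ t /\
  forall q, 1 <= q < digit_base t N -> (2 * q) ^ t <= 2 * N.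
Proof.
  intros ht. destruct (least_spec (fun q => 2 * N <? (2 * q) ^ t) N 1) as (h1 & h2 & h3).
  - apply Nat.ltb_lt. apply Nat.lt_le_trans with ((2 * (1 + N)) ^ 1).
    + rewrite Nat.pow_1_r. lia.
    + apply Nat.pow_le_mono_r; lia.
  - fold (digit_base t N) in *. split; [lia|]. split; [now apply Nat.ltb_lt|].
    intros q hq. now apply Nat.ltb_ge, h3.
Qed.

(** * Polynomial bounds and word length *)

Definition polynomial (f : nat -> nat) : Prop := exists e, forall N, f N <= (N + 2) ^ e.

Lemma polynomial_const v : polynomial (fun _ => v).
Proof.
  exists v. intros N. apply Nat.lt_le_incl, Nat.pow_gt_lin_r. lia.
Qed.

Lemma polynomial_id : polynomial (fun N => N).
Proof. exists 1. intros N. rewrite Nat.pow_1_r. lia. Qed.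

Lemma polynomial_mul f g : polynomial f -> polynomial g -> polynomial (fun N => f N * g N).
Proof.
  intros [a ha] [b hb]. exists (a + b). intros N. rewrite Nat.pow_add_r.
  now apply Nat.mul_le_mono.
Qed.

Lemma polynomial_add f g : polynomial f -> polynomial g -> polynomial (fun N => f N + g N).
Proof.
  intros [a ha] [b hb]. exists (S (a + b)). intros N. rewrite Nat.pow_succ_r', Nat.pow_add_r.
  specialize (ha N); specialize (hb N).
  assert ((N + 2) ^ a <> 0) by (apply Nat.pow_nonzero; lia).
  assert ((N + 2) ^ b <> 0) by (apply Nat.pow_nonzero; lia).
  nia.
Qed.

Lemma polynomial_pow f n : polynomial f -> polynomial (fun N => f N ^ n).
Proof.
  intros h. induction n as [|n IH]; [apply (polynomial_const 1)|].
  exact (polynomial_mul _ _ h IH).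
Qed.

(** [N + 2] is at most the square of [2 ^ (1 + Nat.log2 N)], which doubles the exponent. *)
Lemma polynomial_word f : polynomial f ->
  exists c, forall N, f N <= 2 ^ (c * (1 + Nat.log2 N)).
Proof.
  intros [e he]. exists (2 * e). intros N. rewrite (he N).
  replace (2 * e * (1 + Nat.log2 N)) with ((1 + Nat.log2 N) * 2 * e) by lia.
  rewrite !Nat.pow_mul_r. apply Nat.pow_le_mono_l. rewrite Nat.pow_2_r.
  assert (N < 2 ^ (1 + Nat.log2 N)).
  { destruct N as [|N]; [simpl; lia|]. apply Nat.log2_spec. lia. }
  assert (2 <= 2 ^ (1 + Nat.log2 N)).
  { rewrite Nat.pow_add_r, Nat.pow_1_r.
    assert (2 ^ Nat.log2 N <> 0) by (apply Nat.pow_nonzero; lia). lia. }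
  nia.
Qed.

Definition stride (k c N : nat) : nat := (2 * top k N) ^ c.

(** A common bound for all variables and addresses, with the digit base replaced by its upper bound
    [N + 1] to be visibly polynomial. *)
Definition value_bound (k t c N : nat) : nat :=
  N + 2 + rounds t (N + 1) + (top k N + 2) + (rounds t (N + 1) + 1) * stride k c N.

Lemma polynomial_value_bound k t c n : polynomial (fun N => value_bound k t c N ^ n).
Proof.
  apply polynomial_pow. unfold value_bound, rounds, colors, stride, top, block.
  repeat first [apply polynomial_const | apply polynomial_id | apply polynomial_add
    | apply polynomial_mul | apply polynomial_pow].
Qed.

Lemma rounds_mono t q q' : q <= q' -> rounds t q <= rounds t q'.
Proof.
  intros h. unfold rounds, colors.
  repeat apply Nat.mul_le_mono; trivial.
Qed.

(** [2 ^ (1 + Nat.log2 m) <= 2 * m] for [m > 0], raised to the power [c]. *)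
Lemma stride_bound k c N : 1 <= k -> 2 ^ (c * (1 + Nat.log2 (top k N))) <= stride k c N.
Proof.
  intros hk. unfold stride. rewrite Nat.mul_comm, Nat.pow_mul_r.
  apply Nat.pow_le_mono_l. rewrite Nat.pow_add_r, Nat.pow_1_r.
  assert (0 < top k N) by (unfold top, block; nia).
  pose proof (Nat.log2_spec (top k N) ltac:(trivial)). lia.
Qed.

(** * The assembled program and its decision property *)

Definition reduction_program (P : program) (k t c : nat) : program :=
  let s := gen (9 + num_regs P) 0 (reduction P k t c) in
  s ++ [JumpZ 7 (length s + 2); Halt true; Halt false].

Definition reduction_time (P : program) (k t c : nat) (T : nat -> nat) (N : nat) : nat :=
  reduction_cost P k t c N (digit_base t N) (T (top k N)) + 1.

(** A halted configuration repeats forever, so bounds up to the halting time hold at all times. *)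
Lemma reach_halted Q B T c b (hT : reach Q B T c (fun c' => answers Q c' b)) :
  (forall t, below B (run Q t c)) /\ answers Q (run Q T c) b.
Proof.
  destruct hT as (n & hn & hb & ha).
  assert (hlate : forall t, n <= t -> run Q t c = run Q n c).
  { intros t ht. replace t with (n + (t - n)) by lia. rewrite run_add. now apply run_halted with b. }
  split; [|now rewrite hlate].
  intros t. destruct (le_lt_dec t n) as [l|l]; [now apply hb|].
  rewrite hlate by lia. now apply hb.
Qed.

Lemma reduction_decides k t P T : 2 <= k -> 1 <= t -> decides_kAP (S k) P T ->
  exists c, decides_kAP k (reduction_program P k t c) (reduction_time P k t c T).
Proof.
  intros hk ht [c hc]. exists c.
  set (sz := S (ssize (reduction P k t c))).
  (* [c] is the word constant of the given program and fixes the segment length; [c'] is that of the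
     reduction, whose values stay below [X ^ sz]. *)
  destruct (polynomial_word _ (polynomial_value_bound k t c sz)) as [c' hc'].
  exists c'. intros N A hA.
  destruct (digit_base_spec t N ht) as ([hq1 hq2] & hq3 & hq4).
  set (q := digit_base t N) in *. set (X := value_bound k t c N) in *.
  set (d := 9 + num_regs P).
  pose proof (rounds_mono t q (N + 1) hq2) as hJ.
  assert (hP : forall j,
    (forall s, fits (c * (1 + Nat.log2 (top k N)))
      (run P s (input (top k N) (round_instance k t N q A j)))) /\
    exists b, answers P (run P (T (top k N)) (input (top k N) (round_instance k t N q A j))) b /\
      (b = true <-> has_kAP (S k) (round_instance k t N q A j))).
  { intros j. apply hc. apply instance_subset. }
  (* Initially register 0 of the simulated program holds [top k N], which therefore fits in a
     word. *)
  assert (htop : top k N < 2 ^ (c * (1 + Nat.log2 (top k N)))).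
  { destruct (hP 0) as [hf _]. destruct (hf 0) as [hf' _]. exact (hf' 0). }
  pose proof (stride_bound k c N ltac:(lia)) as hZ.
  assert (hX : 2 <= X) by (unfold X, value_bound; lia).
  assert (hbig : (rounds t q + 1) * stride k c N <= X).
  { unfold X, value_bound. pose proof (Nat.mul_le_mono_r _ _ (stride k c N) hJ). lia. }
  assert (hXB : X <= X ^ sz).
  { rewrite <- (Nat.pow_1_r X) at 1. apply Nat.pow_le_mono_r; unfold sz; lia. }
  assert (hin : forall a, Nat.b2n (A a) < X) by (intros a; pose proof (b2n_le (A a)); lia).
  assert (hreg : forall r, reg (input N A) r < X).
  { intros r. simpl. apply update_lt; [lia|]. unfold X, value_bound. lia. }
  set (Q := reduction_program P k t c).
  assert (hcode : code_at Q 0 (gen d 0 (reduction P k t c)) /\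
    code_at Q (length (gen d 0 (reduction P k t c)))
      [JumpZ 7 (length (gen d 0 (reduction P k t c)) + 2); Halt true; Halt false]).
  { apply (code_at_app Q 0). intros i ins hi. exact hi. }
  destruct hcode as [hcode1 hcode2].
  apply code_at_cons in hcode2; destruct hcode2 as [i1 hcode2].
  apply code_at_cons in hcode2; destruct hcode2 as [i2 hcode2].
  apply code_at_cons in hcode2; destruct hcode2 as [i3 _].
  assert (hreach : exists b, reach Q (X ^ sz) (reduction_time P k t c T N) (input N A)
    (fun c' => answers Q c' b) /\ (b = true <-> has_kAP k A)).
  { pose proof (round_instances_correct k t N q A hk ht hq1 hq3 hA) as hcorrect.
    assert (hb : below (X ^ sz) (input N A)).
    { split; [intros r; specialize (hreg r)|intros a; cbn [input mem]; specialize (hin a)]; lia. }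
    assert (hh : hoare X d sz (reduction P k t c) (reduction_cost P k t c N q (T (top k N)))
      (initial N A) (pending k t c N q A 0)).
    { apply (reduction_correct P k t c N q (T (top k N)) (c * (1 + Nat.log2 (top k N))) A X sz);
        trivial; try (unfold X, value_bound; lia); unfold sz; lia. }
    assert (hr := hh (sok_reduction P k t c) ltac:(unfold sz; lia) Q (input N A) hcode1 hb
      (conj (fun y _ => hreg y) hin) (conj eq_refl (conj eq_refl (fun a => eq_refl)))).
    destruct hr as (n & hn & hbn & e1 & hbd & _ & _ & _ & _ & [_ h7] & _).
    change (pc (run Q n (input N A)) = length (gen d 0 (reduction P k t c))) in e1.
    set (c1 := run Q n (input N A)) in *. rewrite <- e1 in i1.
    assert (hfin : reach Q (X ^ sz) 1 c1 (fun c2 => answers Q c2 (negb (reg c1 7 =? 0)))).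
    { apply reach_step; [now apply hbn|]. unfold step; rewrite i1.
      apply reach_here; [apply (hbn n); lia|]. unfold answers. cbn [pc].
      destruct (reg c1 7 =? 0); simpl negb.
      - rewrite e1 in *. rewrite <- i3. f_equal. lia.
      - rewrite e1. exact i2. }
    exists (negb (reg c1 7 =? 0)). split.
    - apply (reach_bind Q _ n 1 _ _ (fun c2 => c2 = c1) _).
      + exists n. split; [apply le_n|]. now split.
      + unfold reduction_time. fold q. lia.
      + intros c2 _ ->. exact hfin.
    - rewrite <- hcorrect, negb_true_iff, Nat.eqb_neq, h7.
      split.
      + intros (j & _ & hj). exists j. exact hj.
      + intros (j & hj). exists j. split; [lia|exact hj]. }
  destruct hreach as (b & hr & hb). apply reach_halted in hr. destruct hr as [hr1 hr2].
  split; [|now exists b].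
  intros s. destruct (hr1 s) as [b1 b2]. specialize (hc' N). cbv beta in hc'. fold X in hc'.
  split; [intros r; specialize (b1 r)|intros a; specialize (b2 a)]; lia.
Qed.

(** * The exponent of the running time *)

(** There are [g * q ^ 3] rounds, each linear in [top k N + T (top k N) + 1]; the search for [q]
    costs only a multiple of [q]. *)
Lemma reduction_time_bound P k t c T : 1 <= t -> exists K, forall N,
  reduction_time P k t c T N <=
  K * (digit_base t N ^ 3 * (top k N + T (top k N) + 1)).
Proof.
  intros ht. unfold reduction_time, reduction_cost, round_cost.
  set (d := 9 + num_regs P).
  set (a1 := cost d (find_base t)); set (a2 := cost d (next_base t)).
  set (a3 := cost d (Asg 3 (e_rounds t))); set (a4 := cost d (start_round k c)).
  set (a5 := cost d (write_cell k t)); set (a6 := cost d (load P k)).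
  set (a7 := cost d collect).
  set (b := a4 + a5 + a6 + a7 + 20). set (g := t * 2 ^ t * (2 * t)).
  exists (a1 + a2 + a3 + 10 + g * b). intros N.
  pose proof (proj1 (proj1 (digit_base_spec t N ht))) as hq.
  assert (hJ : rounds t (digit_base t N) = g * digit_base t N ^ 3).
  { unfold rounds, colors, g. simpl Nat.pow. ring. }
  rewrite hJ; clear hJ. generalize dependent (digit_base t N). intros q hq.
  generalize (top k N) (T (top k N)). intros M T'. clearbody a1 a2 a3 a4 a5 a6 a7 g.
  assert (hqc : q <= q ^ 3) by (simpl; nia).
  assert (hU : a4 + ((M + 1) * (a5 + 3) + 1 + (a6 + (3 * T' + 3 + a7))) + 3 <= b * (M + T' + 1))
    by (unfold b; nia).
  clearbody b. generalize dependent (a4 + ((M + 1) * (a5 + 3) + 1 + (a6 + (3 * T' + 3 + a7))) + 3).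
  intros V hV. set (U := M + T' + 1) in *. assert (1 <= U) by lia. clearbody U.
  generalize dependent (q ^ 3). intros C hC.
  assert (h1 : C <= C * U) by nia. assert (h2 : q * (a2 + 3) <= (a2 + 3) * (C * U)) by nia.
  assert (h3 : g * C * V <= g * b * (C * U)).
  { replace (g * b * (C * U)) with (g * C * (b * U)) by ring. now apply Nat.mul_le_mono_l. }
  assert (h4 : a1 + a3 + 3 <= (a1 + a3 + 3) * (C * U)) by nia.
  lia.
Qed.

(** Minimality of [q]: for [q >= 2] the base [q - 1] fails, and [q <= 2 * (q - 1)]. *)
Lemma digit_base_pow_le t N M : 1 <= t -> 1 <= M -> 2 * N <= M -> digit_base t N ^ t <= M.
Proof.
  intros ht hM hN. destruct (digit_base_spec t N ht) as ([h1 _] & _ & h3).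
  set (q := digit_base t N) in *. clearbody q.
  destruct (Nat.eq_dec q 1) as [->|ne]; [now rewrite Nat.pow_1_l|].
  transitivity ((2 * (q - 1)) ^ t); [apply Nat.pow_le_mono_l; lia|].
  etransitivity; [apply h3; lia|exact hN].
Qed.

Lemma top_le k N : 1 <= N -> top k N <= (5 * k + 2) * N.
Proof. intros h. unfold top, block. nia. Qed.

Lemma le_top k N : 1 <= k -> N <= top k N /\ 1 <= top k N /\ 2 * N <= top k N.
Proof. intros h. unfold top, block. nia. Qed.

Open Scope R_scope.

Lemma digit_base_cube t N M e : (1 <= t)%nat -> (1 <= M)%nat -> (2 * N <= M)%nat ->
  3 <= e * INR t -> INR (digit_base t N ^ 3) <= Rpower (INR M) e.
Proof.
  intros ht hM hN he. destruct (digit_base_spec t N ht) as ([h1 _] & _ & _).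
  pose proof (digit_base_pow_le t N M ht hM hN) as h2.
  set (q := digit_base t N) in *. clearbody q.
  apply le_INR in h1, h2, ht, hM. rewrite pow_INR in *. change (INR 1) with 1 in *.
  assert (hq0 : 0 < INR q) by lra.
  rewrite <- (Rpower_pow 3) by trivial.
  apply Rle_trans with (Rpower (Rpower (INR q) (INR t)) e).
  - rewrite Rpower_mult. apply Rle_Rpower; trivial. simpl INR. lra.
  - rewrite Rpower_pow by trivial.
    apply Rle_Rpower_l; [nra|]. split; trivial. now apply pow_lt.
Qed.

(** With [M = top k N], the rounds contribute [M ^ (e / 2)] and one round [M ^ (2 - e)], in total
    [M ^ (2 - e / 2)]. The linear terms are absorbed because [e <= 1], and [M] is linear in [N]. *)
Lemma reduction_time_bigO P k t c T eps e : (1 <= k)%nat -> (1 <= t)%nat ->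
  0 < e -> e <= 1 -> e <= eps -> 6 <= e * INR t ->
  bigO_pow T (2 - eps) -> bigO_pow (reduction_time P k t c T) (2 - e / 2).
Proof.
  intros hk ht he he1 heps het (C & N0 & hT).
  destruct (reduction_time_bound P k t c T ht) as [K hK].
  set (a := INR (5 * k + 2)).
  (* The 2 pays for the terms [M] and 1, the power of [a] for [M <= a * N]. [C] may be negative,
     hence [Rabs]. *)
  exists (INR K * ((2 + Rabs C) * Rpower a (2 - e / 2))), (max 1 N0).
  intros N hN. assert (hN1 : (1 <= N)%nat) by lia.
  destruct (le_top k N hk) as (hM & hM1 & hM2). pose proof (top_le k N hN1) as hM3.
  specialize (hK N). specialize (hT (top k N) ltac:(lia)).
  set (M := top k N) in *. clearbody M.
  pose proof (digit_base_cube t N M (e / 2) ht hM1 hM2 ltac:(lra)) as hq.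
  apply le_INR in hK, hM1, hM3, hN1. change (INR 1) with 1 in *.
  apply Rle_trans with (1 := hK). rewrite !mult_INR, !plus_INR. change (INR 1) with 1.
  rewrite mult_INR in hM3. fold a in hM3.
  rewrite Rmult_assoc. apply Rmult_le_compat_l; [apply pos_INR|].
  set (y := INR M) in *. set (x := INR N) in *.
  assert (ha : 0 < a) by (unfold a; apply lt_0_INR; lia).
  assert (hy : Rpower y (2 - e / 2) <= Rpower a (2 - e / 2) * Rpower x (2 - e / 2)).
  { rewrite Rpower_mult_distr by lra. apply Rle_Rpower_l; lra. }
  assert (hTM : INR (T M) <= Rabs C * Rpower y (2 - e)).
  { apply Rle_trans with (1 := hT). apply Rle_trans with (Rabs C * Rpower y (2 - eps)).
    - apply Rmult_le_compat_r; [|apply Rle_abs]. apply Rlt_le, exp_pos.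
    - apply Rmult_le_compat_l; [apply Rabs_pos|]. apply Rle_Rpower; lra. }
  assert (hlin : y <= Rpower y (2 - e)).
  { rewrite <- (Rpower_1 y) at 1 by lra. apply Rle_Rpower; lra. }
  assert (hsum : y + INR (T M) + 1 <= (2 + Rabs C) * Rpower y (2 - e)) by lra.
  apply Rle_trans with (Rpower y (e / 2) * ((2 + Rabs C) * Rpower y (2 - e))).
  - apply Rmult_le_compat; trivial; [apply pos_INR|]. pose proof (pos_INR (T M)). lra.
  - replace (Rpower y (e / 2) * ((2 + Rabs C) * Rpower y (2 - e)))
      with ((2 + Rabs C) * (Rpower y (e / 2) * Rpower y (2 - e))) by ring.
    rewrite <- Rpower_plus. replace (e / 2 + (2 - e)) with (2 - e / 2) by field.
    rewrite Rmult_assoc. apply Rmult_le_compat_l; trivial.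
    pose proof (Rabs_pos C). lra.
Qed.

Lemma kAP_hypothesis_succ k : (2 <= k)%nat -> kAP_hypothesis k -> kAP_hypothesis (S k).
Proof.
  intros hk hyp eps heps (P & T & hdec & hT).
  set (e := Rmin eps 1).
  assert (he : 0 < e) by (apply Rmin_glb_lt; lra).
  (* With [t > 6 / e] the factor [q ^ 3] consumes at most half of the saving [e]. *)
  destruct (INR_unbounded (6 / e)) as [t ht].
  assert (het : 6 <= e * INR t).
  { apply Rlt_le. apply Rmult_lt_compat_l with (r := e) in ht; trivial.
    now replace (e * (6 / e)) with 6 in ht by (field; lra). }
  assert (ht1 : (1 <= t)%nat) by (destruct t; [simpl in het; lra|lia]).
  destruct (reduction_decides k t P T hk ht1 hdec) as [c hc].
  apply (hyp (e / 2)); [lra|].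
  exists (reduction_program P k t c), (reduction_time P k t c T). split; trivial.
  apply (reduction_time_bigO P k t c T eps e); trivial; try lia; [apply Rmin_r|apply Rmin_l].
Qed.

Close Scope R_scope.

Theorem theorem5p3 (k : nat) (hk : 4 <= k) :
  kAP_hypothesis k -> forall k' : nat, k <= k' -> kAP_hypothesis k'.
Proof.
  intros hyp k' hk'. induction hk' as [|k' hk' IH]; trivial.
  apply kAP_hypothesis_succ; trivial. lia.
Qed.
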